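(* Let $t$ be a fixed integer (treated as a constant). The $K_t$-free edge deletion problem has a kernel with $O(k^{t-1})$ vertices and edges. That is, there is a polynomial-time algorithm that, given an instance $(G,k)$ of $K_t$-free edge deletion, outputs an instance $(G',k')$ of $K_t$-free edge deletion such that $(G,k)$ is a yes-instance if and only if $(G',k')$ is a yes-instance, $k' \le k$, and $G'$ has $O(k^{t-1})$ vertices and $O(k^{t-1})$ edges (the constants in the $O$-notation depending only on $t$).
   Context: In the $K_t$-free edge deletion problem, the input is a (finite, simple, undirected) graph $G$ and an integer $k$, and the question is whether there is a set of at most $k$ edges of $G$ whose removal results in a graph containing no clique on $t$ vertices. An instance is a yes-instance if the answer is yes. *)

(* Defs.v *)
From HB Require Import structures.
From mathcomp Require Import all_boot.

Set Implicit Arguments.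
Unset Strict Implicit.
Unset Printing Implicit Defensive.

(* Machine model for "polynomial time": deterministic single-tape      *)
(* Turing machines with finitely many states over the tape alphabet    *)
(* {blank, 0, 1} = option bool (None = blank).                          *)

Record TM := MkTM {
  tmQ : finType;
  tm_start : tmQ;
  tm_halt : tmQ -> bool;
  tm_delta : tmQ -> option bool -> tmQ * option bool * bool
    (* new state, written symbol, move (true = right, false = left) *)
}.

Record config (M : TM) := Config {
  cst : tmQ M;
  cleft : seq (option bool);   (* cells left of the head, nearest first *)
  chead : option bool;
  cright : seq (option bool)   (* cells right of the head, nearest first *)
}.

(* One step; halting configurations are fixed points.  The tape is
   two-way infinite, filled with blanks outside the listed cells. *)
Definition step (M : TM) (c : config M) : config M :=
  let: Config q l h r := c in
  if @tm_halt M q then c else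
  let: (q', w, d) := @tm_delta M q h in
  if d then Config q' (w :: l) (head None r) (behead r)
  else Config q' (behead l) (head None l) (w :: r).

Definition init (M : TM) (w : seq bool) : config M :=
  Config (@tm_start M) [::] (head None (map Some w)) (behead (map Some w)).

Fixpoint read_word (s : seq (option bool)) : seq bool :=
  match s with
  | Some b :: s' => b :: read_word s'
  | _ => [::]
  end.

Definition output (M : TM) (c : config M) : seq bool :=
  read_word (chead c :: cright c).

Definition runs_within (M : TM) (w : seq bool) (T : nat) (out : seq bool) :=
  exists n, n <= T /\ @tm_halt M (cst (iter n (@step M) (init M w)))
            /\ @output M (iter n (@step M) (init M w)) = out.

Definition poly_time_computable (f : seq bool -> seq bool) :=
  exists (M : TM) (c : nat),
    forall w, runs_within M w (c * size w ^ c + c) (f w).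

Record sgraph := SGraph {
  gn : nat;
  gadj : rel 'I_gn;
  gadj_sym : symmetric gadj;
  gadj_irr : irreflexive gadj
}.

Definition edges (G : sgraph) : {set {set 'I_(gn G)}} :=
  [set [set p.1; p.2] | p in [set p : 'I_(gn G) * 'I_(gn G) | @gadj G p.1 p.2]].

Definition has_clique (t n : nat) (adj : rel 'I_n) : Prop :=
  exists K : {set 'I_n}, #|K| = t /\ {in K &, forall x y, x != y -> adj x y}.

Definition yes_instance (t : nat) (G : sgraph) (k : nat) : Prop :=
  exists F : {set {set 'I_(gn G)}},
    [/\ F \subset edges G, #|F| <= k &
        ~ has_clique t (fun x y => @gadj G x y && ([set x; y] \notin F))].

(* little-endian binary digits of k, no leading zeros *)
Fixpoint bin_aux (fuel k : nat) : seq bool :=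
  match fuel with
  | 0 => [::]
  | f.+1 => if k is 0 then [::] else odd k :: bin_aux f k./2
  end.
Definition bin (k : nat) : seq bool := bin_aux k k.

Definition encode (I : sgraph * nat) : seq bool :=
  let: (G, k) := I in
  nseq (gn G) true ++ false ::
    [seq @gadj G i j | i <- enum 'I_(gn G), j <- enum 'I_(gn G)] ++ bin k.

(* Main.v *)
From Stdlib Require Import ZArith Lia FunctionalExtensionality.
Require Import Defs.
From mathcomp Require Import all_boot.
From mathcomp Require Import zify.

(** The kernel.  Let [F_0] be the set of [t]-tuples of pairwise adjacent vertices,
    linearly ordered.  For [s = t - 1, ..., 0] discard a tuple [x] if, for some set
    [P] of [s] coordinates, at least [thr s] of the surviving smaller tuples agree
    with [x] on [P], where [thr s] is about [(c (k+1)) ^ (t - s)] for [s > 0] and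
    [(c (k+1)) ^ (t - 1)] for [s = 0].  The union of the finally surviving cliques is
    the output graph; [k] is unchanged.  If at most [k] edges hit all tuples surviving
    a round, they hit all tuples [x] that entered it: for the smallest tuple [x] not
    hit, the [thr s] smaller tuples agreeing with [x] on [P] are hit by an edge not
    inside [P], hence pass through one of [2k] vertices at a further coordinate (for
    [P] empty: through one of [k] edges), and the previous rounds left fewer than
    [thr s] of these.

    The running time.  Survival is expressible by nested bounded sums and
    comparisons, so the kernel is computed by a loop program with a fixed number of
    polynomially bounded counters.  Such programs run on a Turing machine whose tape
    is cut into blocks of bits: block [i] holds the input bit [i] and one mark for
    every counter with value [i]. *)

Set Implicit Arguments.
Unset Strict Implicit.
Unset Printing Implicit Defensive.

Local Open Scope nat_scope.

(** * Turing machine fragments *)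

(** Ordered tuples replace cliques because coordinates name their parts: [P] ranges over subsets of
    a fixed [t]-element set, so each round makes only constantly many tests. Only smaller tuples
    count against [x]; this makes the argument about a smallest tuple that is not hit possible.

    The exponent [t - 1] is decided in the last round. Prescribing one coordinate after another
    costs a factor [k] each, which would give [k ^ t]. But a deleted edge fixes two coordinates at
    once for a single factor [k], so the count without prescribed coordinates goes directly to the
    count with two.

    As [k] is written in binary, it can be exponential in the input length and out of reach of
    bounded counters. The thresholds use [kap], the minimum of [k + 1] and the input length. Where
    the cap is active, [k] is at least the number of edges, and for [t > 1] all of them may be
    deleted.

    No family of tuples is ever stored: as [t] is constant, membership after [j] rounds unfolds into
    an expression of constant size, which is recomputed whenever it is needed. *)

Notation sym := (option bool).

Definition upd (T : Z -> sym) (p : Z) (x : sym) : Z -> sym :=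
  fun q => if Z.eqb q p then x else T q.

(** Coordinates grow to the left, against the reading direction: the growing work area gets the
    positive cells, while input and output occupy the cells -1, -2 and so on. *)
Definition shiftn (d : bool) (k : nat) (p : Z) : Z :=
  if d then Z.sub p (Z.of_nat k) else Z.add p (Z.of_nat k).

Arguments shiftn : simpl never.

Lemma upd_id T p : upd T p (T p) = T.
Proof.
by apply: functional_extensionality => q; rewrite /upd; case: Z.eqb_spec => [->|].
Qed.

(** [E] is the type of exits, so that a fragment returns a value through its control. The start may
    itself be an exit: [ret] takes no step, and gluing fragments together adds none. *)
Record frag (E : finType) := Frag {
  fQ : finType;
  fstart : fQ + E;
  fdelta : fQ -> sym -> (fQ + E) * sym * bool
}.

Section Run.
Variables (E : finType) (M : frag E).

Definition fstep (c : (fQ M + E) * ((Z -> sym) * Z)) :=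
  match c.1 with
  | inr _ => c
  | inl q => let: (q', x, d) := fdelta q (c.2.1 c.2.2) in
             (q', (upd c.2.1 c.2.2 x, shiftn d 1 c.2.2))
  end.

Definition runs tp n e tp' :=
  exists2 n', n' <= n & iter n' fstep (fstart M, tp) = (inr e, tp').

Lemma runs_leq tp n n' e tp' : n <= n' -> runs tp n e tp' -> runs tp n' e tp'.
Proof. by move=> le_n [a le_a ?]; exists a => //; apply: leq_trans le_n. Qed.

End Run.

Definition ret (E : finType) (e : E) : frag E :=
  @Frag E void (inr e) (fun q _ => match q with end).

Lemma runs_ret (E : finType) (e : E) tp : runs (ret e) tp 0 e tp.
Proof. by exists 0. Qed.

Definition act (E : finType) (f : sym -> sym * bool * E) : frag E :=
  @Frag E unit (inl tt) (fun _ s => let: (x, d, e) := f s in (inr e, x, d)).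

Lemma runs_act (E : finType) (f : sym -> sym * bool * E) T p x d e :
  f (T p) = (x, d, e) -> runs (act f) (T, p) 1 e (upd T p x, shiftn d 1 p).
Proof. by move=> fE; exists 1 => //=; rewrite /fstep /= fE. Qed.

Section Bind.
Variables (E E' : finType) (M : frag E) (K : E -> frag E').

(** Each continuation [K e] gets its own copy of control, which remembers the exit value [e] without
    using the tape. *)
Definition bindQ : finType := (fQ M + {e : E & fQ (K e)})%type.

Definition bind_emb2 (e : E) (c : fQ (K e) + E') : bindQ + E' :=
  match c with
  | inl q => inl (inr (Tagged (fun e => fQ (K e)) q))
  | inr e' => inr e'
  end.

Definition bind_emb1 (c : fQ M + E) : bindQ + E' :=
  match c with
  | inl q => inl (inl q)
  | inr e => bind_emb2 (fstart (K e))
  end.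

Definition bind : frag E' :=
  @Frag E' bindQ (bind_emb1 (fstart M)) (fun c s =>
    match c with
    | inl q => let: (q', x, d) := fdelta q s in (bind_emb1 q', x, d)
    | inr u => let: (q', x, d) := fdelta (tagged u) s in (bind_emb2 q', x, d)
    end).

(** Only an inequality holds, because [fstep] idles at an exit of [M]; in [bind] the continuation
    would already be running, so the idle steps are dropped. *)
Lemma bind_run1 n c tp e tp' :
  iter n (@fstep _ M) (c, tp) = (inr e, tp') ->
  exists2 n', n' <= n &
    iter n' (@fstep _ bind) (bind_emb1 c, tp) = (bind_emb2 (fstart (K e)), tp').
Proof.
elim: n c tp => [|n IHn] c tp; first by case=> -> ->; exists 0.
rewrite iterSr; case: c => [q|e0].
  rewrite {2}/fstep /=; case fE: (fdelta q _) => [[q' x] d] /IHn [n' le_n' run].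
  by exists n'.+1 => //; rewrite iterSr {2}/fstep /= fE.
by rewrite {2}/fstep /= => /IHn [n' le_n' run]; exists n' => //; apply: leqW.
Qed.

Lemma bind_run2 n e c tp e' tp' :
  iter n (@fstep _ (K e)) (c, tp) = (inr e', tp') ->
  iter n (@fstep _ bind) (bind_emb2 c, tp) = (inr e', tp').
Proof.
elim: n c tp => [|n IHn] c tp; first by case=> -> ->.
rewrite !iterSr; case: c => [q|e0] /=.
  by rewrite {2 4}/fstep /=; case fE: (fdelta q _) => [[q' x] d] /IHn.
by rewrite {2 4}/fstep /= => /IHn.
Qed.

Lemma runs_bind tp n e tp1 n' e' tp2 :
  runs M tp n e tp1 -> runs (K e) tp1 n' e' tp2 -> runs bind tp (n + n') e' tp2.
Proof.
move=> [a le_a /bind_run1 [a' le_a' runa]] [b le_b /bind_run2 runb].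
exists (b + a'); first by rewrite addnC leq_add // (leq_trans le_a').
by rewrite iterD runa.
Qed.

End Bind.

Section Loop.
Variables (E : finType) (M : frag (option E)).

(* The extra state absorbs the degenerate body that asks for a restart
   without taking a step. *)
Definition loop_emb (c : fQ M + option E) : option (fQ M) + E :=
  match c with
  | inl q => inl (Some q)
  | inr (Some e) => inr e
  | inr None => match fstart M with
                | inl q => inl (Some q)
                | inr (Some e) => inr e
                | inr None => inl None
                end
  end.

Definition loop : frag E :=
  @Frag E (option (fQ M)) (loop_emb (inr None)) (fun c s =>
    match c with
    | Some q => let: (q', x, d) := fdelta q s in (loop_emb q', x, d)
    | None => (inl None, s, true)
    end).

Lemma loop_run n c tp oe tp' :
  iter n (@fstep _ M) (c, tp) = (inr oe, tp') ->
  exists2 n', n' <= n &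
    iter n' (@fstep _ loop) (loop_emb c, tp) = (loop_emb (inr oe), tp').
Proof.
elim: n c tp => [|n IHn] c tp; first by case=> -> ->; exists 0.
rewrite iterSr; case: c => [q|e0].
  rewrite {2}/fstep /=; case fE: (fdelta q _) => [[q' x] d] /IHn [n' le_n' run].
  by exists n'.+1 => //; rewrite iterSr {2}/fstep /= fE.
by rewrite {2}/fstep /= => /IHn [n' le_n' run]; exists n' => //; apply: leqW.
Qed.

Lemma loop_start : loop_emb (fstart M) = loop_emb (inr None).
Proof. by rewrite /loop_emb; case: (fstart M) => [q|[e|]]. Qed.

Lemma runs_loop_stop tp n e tp' :
  runs M tp n (Some e) tp' -> runs loop tp n e tp'.
Proof.
move=> [a le_a /loop_run [a' le_a' run]].
exists a'; first exact: leq_trans le_a.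
by rewrite -[fstart loop]loop_start run.
Qed.

Lemma runs_loop_again tp n tp1 n' e tp2 :
  runs M tp n None tp1 -> runs loop tp1 n' e tp2 -> runs loop tp (n + n') e tp2.
Proof.
move=> [a le_a /loop_run [a' le_a' runa]] [b le_b runb].
exists (b + a'); first by rewrite addnC leq_add // (leq_trans le_a').
by rewrite iterD -[fstart loop]loop_start runa.
Qed.

End Loop.

Arguments bind {E E'} M K.
Arguments loop {E} M.
Arguments act {E} f.
Arguments ret {E} e.

Notation "x <~ M ;; K" := (bind M (fun x => K))
  (at level 100, M at next level, K at level 200, right associativity).
Notation "M ;; K" := (bind M (fun _ => K))
  (at level 100, K at level 200, right associativity).

Section FragTM.
Variable (M : frag unit).

Definition frag_TM : TM :=
  @MkTM (fQ M + unit)%type (fstart M) (fun q => if q is inr _ then true else false)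
    (fun q s => match q with inl q => fdelta q s | inr e => (inr e, s, true) end).

(** Lists that differ by trailing blanks describe the same tape; comparing them through [nth None]
    makes the difference invisible. *)
Definition tape_of (c : config frag_TM) (c' : (fQ M + unit) * ((Z -> sym) * Z)) :=
  [/\ cst c = c'.1, c'.2.1 c'.2.2 = chead c,
      forall i, c'.2.1 (shiftn false i.+1 c'.2.2) = nth None (cleft c) i
    & forall i, c'.2.1 (shiftn true i.+1 c'.2.2) = nth None (cright c) i].

Lemma tape_of_step c c' : tape_of c c' -> tape_of (step c) (fstep c').
Proof.
case: c c' => [q l h r] [q' [T p]] [/= -> hE lE rE].
rewrite /step /fstep /=; case: q' => [q'|e] //=.
rewrite hE; case: (fdelta q' h) => [[q2 x] d].
have shE b i : shiftn b i.+1 p <> p by rewrite /shiftn; case: b; lia.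
have ntE (s : seq sym) : forall i, nth None (behead s) i = nth None s i.+1.
  by move=> i; rewrite nth_behead.
case: d; split=> //=.
- by rewrite /upd; case: Z.eqb_spec => [e|_]; [case: (shE _ _ e) | rewrite (rE 0) nth0].
- case=> [|i]; rewrite /upd.
    by case: Z.eqb_spec => //; rewrite /shiftn; lia.
  case: Z.eqb_spec => [|_]; first by rewrite /shiftn; lia.
  by rewrite -[RHS]lE; congr T; rewrite /shiftn; lia.
- move=> i; rewrite ntE -rE /upd.
  case: Z.eqb_spec => [|_]; first by rewrite /shiftn; lia.
  by congr T; rewrite /shiftn; lia.
- by rewrite /upd; case: Z.eqb_spec => [e|_]; [case: (shE _ _ e) | rewrite (lE 0) nth0].
- move=> i; rewrite ntE -lE /upd.
  case: Z.eqb_spec => [|_]; first by rewrite /shiftn; lia.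
  by congr T; rewrite /shiftn; lia.
- case=> [|i]; rewrite /upd.
    by case: Z.eqb_spec => //; rewrite /shiftn; lia.
  case: Z.eqb_spec => [|_]; first by rewrite /shiftn; lia.
  by rewrite -[RHS]rE; congr T; rewrite /shiftn; lia.
Qed.

Definition word_tape (w : seq bool) (p : Z) : sym :=
  if Z.ltb p 0 then onth w (Z.to_nat (- p - 1)) else None.

Lemma nth_map_Some (w : seq bool) i : nth None (map Some w) i = onth w i.
Proof. by rewrite onthE. Qed.

Lemma read_wordE (s : seq sym) (w : seq bool) :
  (forall i, nth None s i = onth w i) -> read_word s = w.
Proof.
elim: s w => [|x s IHs] [|b w] sE //; first by have := sE 0.
  by have /= := sE 0 => ->.
have /= -> := sE 0; congr cons; apply: IHs => i.
exact: (sE i.+1).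
Qed.

Lemma runs_TM w n T p out :
  runs M (word_tape w, (-1)%Z) n tt (T, p) ->
  (forall i, T (shiftn true i p) = onth out i) ->
  runs_within frag_TM w n out.
Proof.
move=> [a le_a run] TE; exists a; split=> //.
have ini : tape_of (init frag_TM w) (fstart M, (word_tape w, (-1)%Z)).
  split=> //=.
  - by rewrite /word_tape /=; case: w {run}.
  - move=> i; rewrite /word_tape /shiftn; case: Z.ltb_spec; last by rewrite nth_nil.
    by lia.
  - move=> i; rewrite nth_behead nth_map_Some /word_tape /shiftn.
    by case: Z.ltb_spec; [move=> _; congr onth; lia | lia].
have /(_ a) : forall b, tape_of (iter b (@step frag_TM) (init frag_TM w))
              (iter b (@fstep _ M) (fstart M, (word_tape w, (-1)%Z))).
  by elim=> [//|b IHb]; rewrite !iterS; apply: tape_of_step.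
rewrite run; case=> [/= -> hE _ rE]; split=> //.
rewrite /output; apply: read_wordE => i; rewrite -TE.
by case: i => [|i] /=; rewrite -?hE -?rE //; rewrite /shiftn; congr T; lia.
Qed.

End FragTM.

(** * Registers on a tape of blocks *)

Lemma shiftn_add d a b p : shiftn d a (shiftn d b p) = shiftn d (b + a) p.
Proof. by rewrite /shiftn; case: d; lia. Qed.

Lemma runs_act_id (E : finType) (f : sym -> sym * bool * E) T p d e :
  f (T p) = (T p, d, e) -> runs (act f) (T, p) 1 e (T, shiftn d 1 p).
Proof. by move=> fE; have := @runs_act _ f T p _ _ _ fE; rewrite upd_id. Qed.

Fixpoint mvn (d : bool) (k : nat) : frag unit :=
  if k is k'.+1 then act (fun s => (s, d, tt)) ;; mvn d k' else ret tt.

Lemma runs_mvn d k T p : runs (mvn d k) (T, p) k tt (T, shiftn d k p).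
Proof.
elim: k p => [|k IHk] p.
  by rewrite (_ : shiftn d 0 p = p) //=; [exact: runs_ret | rewrite /shiftn; case: d; lia].
rewrite -(addn1 k) addnC -shiftn_add.
by apply: runs_bind (IHk _); apply: (@runs_act_id _ _ T).
Qed.

Fixpoint wr (s : seq bool) : frag unit :=
  if s is b :: s' then act (fun _ => (Some b, false, tt)) ;; wr s' else ret tt.

Definition updl (T : Z -> sym) (p : Z) (s : seq bool) : Z -> sym :=
  fun q => if (Z.leb p q && Z.ltb q (p + Z.of_nat (size s)))%Z
           then Some (nth false s (Z.to_nat (q - p))) else T q.

Lemma runs_wr s T p :
  runs (wr s) (T, p) (size s) tt (updl T p s, shiftn false (size s) p).
Proof.
elim: s T p => [|b s IHs] T p.
  rewrite (_ : shiftn _ _ p = p); last by rewrite /shiftn /=; lia.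
  rewrite (_ : updl _ _ _ = T); first exact: runs_ret.
  by apply: functional_extensionality => q; rewrite /updl /=; case: ifP => //; lia.
rewrite (_ : updl T p _ = updl (upd T p (Some b)) (shiftn false 1 p) s); last first.
  apply: functional_extensionality => q; rewrite /updl /upd /shiftn.
  rewrite [size _]/=; case: (Z.eqb_spec q p) => [->|ne_qp].
    rewrite (_ : Z.to_nat (p - p) = 0); last by lia.
    by do 2 case: ifP; try lia.
  case: ifP => h1; case: ifP => h2 //; try lia.
  by rewrite (_ : Z.to_nat (q - p) = (Z.to_nat (q - (p + Z.of_nat 1))).+1) //; lia.
rewrite /= -add1n -shiftn_add.
by apply: runs_bind (IHs _ _); apply: (@runs_act _ _ T).
Qed.

Arguments mvn : simpl never.
Arguments wr : simpl never.

(** Cell 0 and the cells beyond both ends of the used tape are blank, so running to the next blank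
    serves for returning, for appending a block and for appending output. *)
Definition skip (d : bool) (x : sym) (d' : bool) : frag unit :=
  loop (act (fun s => if s is Some _ then (s, d, None) else (x, d', Some tt))).

Lemma runs_skip d x d' n T p :
  (forall i, i < n -> T (shiftn d i p) <> None) -> T (shiftn d n p) = None ->
  runs (skip d x d') (T, p) n.+1 tt
    (upd T (shiftn d n p) x, shiftn d' 1 (shiftn d n p)).
Proof.
elim: n p => [|n IHn] p Tn T0.
  have p0 : shiftn d 0 p = p by rewrite /shiftn; case: (d); lia.
  rewrite p0 in T0 *; apply: runs_loop_stop; apply: (@runs_act _ _ T).
  by rewrite T0.
rewrite -(add1n n) -(shiftn_add d n) -addnS.
apply: (@runs_loop_again _ _ _ _ (T, shiftn d 1 p)).
  apply: (@runs_act_id _ _ T).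
  have := Tn 0 isT; rewrite (_ : shiftn d 0 p = p); last by rewrite /shiftn; case: (d); lia.
  by case: (T p).
apply: IHn; last by rewrite shiftn_add.
by move=> i lt_in; rewrite shiftn_add; apply: Tn.
Qed.

Definition updR (R : nat -> nat) j v : nat -> nat := fun i => if i == j then v else R i.

(** * Primitive register operations on the block tape *)

Section Prims.
Variable m : nat.
Notation B := m.+2.

Definition pos i o : Z := Z.of_nat (B * i + o).+1.

Definition cbit (w : seq bool) (R : nat -> nat) i o : bool :=
  match o with 0 => i < size w | 1 => nth false w i | j.+2 => R j == i end.

(* Cell 0 is blank.  To its left lie [L] blocks of [m.+2] bits; block [i] records
   whether [i] is a position of the input, the input bit, and which of the [m]
   registers have value [i].  To its right lies the output. *)
Definition cont w R L out : Z -> sym := fun p =>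
  if Z.eqb p 0 then None
  else if Z.ltb p 0 then onth out (Z.to_nat (- p - 1))
  else let i := Z.to_nat (p - 1) in
       if i < B * L then Some (cbit w R (i %/ B) (i %% B)) else None.

Lemma cont0 w R L out : cont w R L out 0%Z = None.
Proof. by []. Qed.

Lemma cont_out w R L out i : cont w R L out (- Z.of_nat i.+1)%Z = onth out i.
Proof.
rewrite /cont; case: Z.eqb_spec => [|_]; first by lia.
by case: Z.ltb_spec; [move=> _; congr onth; lia | lia].
Qed.

Lemma cont_pos w R L out i o : o < B ->
  cont w R L out (pos i o) = if i < L then Some (cbit w R i o) else None.
Proof.
move=> lt_oB; rewrite /cont; case: Z.eqb_spec => [|_]; first by rewrite /pos; lia.
case: Z.ltb_spec; first by rewrite /pos; lia.
rewrite (_ : Z.to_nat _ = i * B + o) => [_ /=|]; last by rewrite /pos; lia.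
rewrite divnMDl // modnMDl divn_small // modn_small // addn0.
by congr (if _ then _ else _); apply/idP/idP; nia.
Qed.

Lemma posP p : [\/ p = 0%Z, exists i, p = (- Z.of_nat i.+1)%Z |
                   exists i o, o < B /\ p = pos i o].
Proof.
case: (Z.ltb_spec p 0) => ?; first by apply: Or32; exists (Z.to_nat (- p - 1)); lia.
case: (Z.eqb_spec p 0) => ?; first exact: Or31.
apply: Or33; exists (Z.to_nat (p - 1) %/ B), (Z.to_nat (p - 1) %% B).
by rewrite ltn_mod; split=> //; rewrite /pos mulnC -divn_eq; lia.
Qed.

Lemma cont_ext T w R L out : T 0%Z = None ->
  (forall i, T (- Z.of_nat i.+1)%Z = onth out i) ->
  (forall i o, o < B -> T (pos i o) = if i < L then Some (cbit w R i o) else None) ->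
  T = cont w R L out.
Proof.
move=> T0 Tout Tpos; apply: functional_extensionality => p.
case: (posP p) => [->|[i ->]|[i [o [lt_oB ->]]]].
- by rewrite T0.
- by rewrite Tout cont_out.
- by rewrite Tpos // cont_pos.
Qed.

Lemma pos_inj i o i' o' : o < B -> o' < B -> pos i o = pos i' o' -> i = i' /\ o = o'.
Proof.
move=> lt_o lt_o' e; have {}e : i * B + o = i' * B + o' by rewrite /pos in e; lia.
split.
  by have := congr1 (divn^~ B) e; rewrite /= !divnMDl // !divn_small // !addn0.
by have := congr1 (modn^~ B) e; rewrite /= !modnMDl !modn_small.
Qed.

Lemma upd_pos T i o x i' o' : o < B -> o' < B ->
  upd T (pos i o) x (pos i' o') = if (i' == i) && (o' == o) then x else T (pos i' o').
Proof.
move=> lt_o lt_o'; rewrite /upd; congr (if _ then _ else _).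
apply/idP/idP => [/Z.eqb_spec /pos_inj[] // -> ->|/andP[/eqP -> /eqP ->]].
  by rewrite !eqxx.
by apply/Z.eqb_spec.
Qed.

Lemma upd_npos T i o x p : (p <= 0)%Z -> upd T (pos i o) x p = T p.
Proof. by rewrite /upd /pos => p_le; case: Z.eqb_spec => //; lia. Qed.

Lemma updl_pos T i s i' o' : size s = B -> o' < B ->
  updl T (pos i 0) s (pos i' o') = if i' == i then Some (nth false s o') else T (pos i' o').
Proof.
move=> szs lt_o'; rewrite /updl szs /pos.
have [->|ne_i] := eqVneq i' i.
  case: ifP => [_|]; last by lia.
  by do 2 f_equal; lia.
case: ifP => // /andP[/Z.leb_le h1 /Z.ltb_lt h2]; exfalso.
have [lt_i|lt_i|] := ltngtP i' i; last by move/eqP: ne_i.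
  by have := leq_mul (leqnn B) lt_i; rewrite mulnS; lia.
by have := leq_mul (leqnn B) lt_i; rewrite mulnS; lia.
Qed.

Lemma updl_npos T i s p : (p <= 0)%Z -> updl T (pos i 0) s p = T p.
Proof. by rewrite /updl /pos => p_le; case: ifP => //; lia. Qed.

Lemma pos_shiftl i o k : shiftn false k (pos i o) = pos i (o + k).
Proof. by rewrite /shiftn /pos; lia. Qed.

Lemma pos_shiftr i o k : k <= o -> shiftn true k (pos i o) = pos i (o - k).
Proof. by rewrite /shiftn /pos; lia. Qed.

Lemma posS i o : pos i (B + o) = pos i.+1 o.
Proof. by rewrite /pos; lia. Qed.

Lemma pos00 : pos 0 0 = 1%Z.
Proof. by rewrite /pos; lia. Qed.

Definition home : frag unit := skip true None false.

Lemma runs_home w R L out q : q <= B * L ->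
  runs home (cont w R L out, Z.of_nat q) q.+1 tt (cont w R L out, 1%Z).
Proof.
move=> le_q; set T := cont _ _ _ _.
have q0 : shiftn true q (Z.of_nat q) = 0%Z by rewrite /shiftn; lia.
have := @runs_skip true None false q T (Z.of_nat q).
rewrite q0 (_ : upd T 0 None = T); last by rewrite -[None](cont0 w R L out) upd_id.
apply=> // i lt_iq; rewrite /shiftn /T /cont.
case: Z.eqb_spec; first by lia.
by case: Z.ltb_spec; [lia | case: ifP => //; lia].
Qed.

Lemma runs_home_pos w R L out i o : i < L -> o < B ->
  runs home (cont w R L out, pos i o) (B * i + o).+2 tt (cont w R L out, 1%Z).
Proof. by move=> lt_iL lt_oB; apply: runs_home; nia. Qed.

Definition find (o : nat) (x : sym) (d : bool) : frag unit :=
  loop (mvn false o ;;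
        b <~ act (fun s => if s == Some true then (x, d, true) else (s, false, false)) ;;
        (* Together with the [o] moves and the test, [B - o.+1] further moves advance by exactly one
           block. *)
        if b then ret (Some tt) else mvn false (B - o.+1) ;; ret None).

Lemma runs_find o x d T i0 : o < B ->
  (forall i, i < i0 -> T (pos i o) <> Some true) -> T (pos i0 o) = Some true ->
  runs (find o x d) (T, 1%Z) (B * i0.+1) tt (upd T (pos i0 o) x, shiftn d 1 (pos i0 o)).
Proof.
move=> lt_oB Tn Ti0; rewrite -pos00.
suff H n i : i + n = i0 -> runs (find o x d) (T, pos i 0) (B * n.+1) tt
          (upd T (pos i0 o) x, shiftn d 1 (pos i0 o)) by apply: H; rewrite add0n.
elim: n i => [|n IHn] i i0E.
  apply: runs_loop_stop; move: i0E; rewrite addn0 => ->.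
  apply: (@runs_leq _ _ _ (o + (1 + 0))); first by lia.
  apply: runs_bind (runs_mvn _ _ _ _) _; rewrite pos_shiftl add0n.
  apply: runs_bind; first by apply: (@runs_act _ _ _ _ x d true); rewrite Ti0.
  exact: runs_ret.
rewrite mulnS; apply: (@runs_loop_again _ _ _ _ (T, pos i.+1 0)); last first.
  by apply: IHn; lia.
apply: (@runs_leq _ _ _ (o + (1 + ((B - o.+1) + 0)))); first by lia.
apply: runs_bind (runs_mvn _ _ _ _) _; rewrite pos_shiftl add0n.
apply: runs_bind.
  apply: (@runs_act_id _ _ T _ false false).
  by case: eqP => // /(Tn i); case; lia.
apply: runs_bind (runs_mvn _ _ _ _) _.
rewrite !pos_shiftl (_ : o + 1 + _ = B + 0); last by lia.
by rewrite posS; apply: runs_ret.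
Qed.

Lemma runs_find_reg w R L out j x d : j < m -> R j < L ->
  runs (find j.+2 x d) (cont w R L out, 1%Z) (B * L) tt
    (upd (cont w R L out) (pos (R j) j.+2) x, shiftn d 1 (pos (R j) j.+2)).
Proof.
move=> lt_jm lt_RL; apply: (@runs_leq _ _ _ (B * (R j).+1)); first by nia.
apply: runs_find => //.
  move=> i lt_i; rewrite cont_pos //; case: ifP => // _ [] /=.
  by apply/negP; rewrite neq_ltn lt_i orbT.
by rewrite cont_pos // lt_RL /= eqxx.
Qed.

(** Values of [R j] or [v] that are at least [L] are allowed; they describe a register whose mark is
    erased, the state between removing a mark and setting the next one. *)
Lemma upd_cont_reg w R L out j i v : j < m -> i < L ->
  (forall i', i' != i -> i' < L -> (R j == i') = (v == i')) ->
  upd (cont w R L out) (pos i j.+2) (Some (v == i)) = cont w (updR R j v) L out.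
Proof.
move=> lt_jm lt_iL Rv; apply: cont_ext.
- by rewrite upd_npos.
- by move=> a; rewrite upd_npos ?cont_out //; lia.
move=> a o lt_o; rewrite upd_pos // cont_pos //.
case: eqP => [->|/eqP ne_a] /=; first case: eqP => [->|/eqP ne_o] /=.
- by rewrite lt_iL /updR eqxx.
- case: ifP => // _; case: o lt_o ne_o => [|[|o]] //= lt_o ne_o.
  by move: ne_o; rewrite /updR !eqSS => /negbTE ->.
case: ifP => // lt_aL; case: o lt_o => [|[|o]] //= lt_o.
by rewrite /updR; have [->|//] := eqVneq o j; rewrite Rv.
Qed.

Definition reset j : frag unit :=
  find j.+2 (Some false) true ;; home ;; mvn false j.+2 ;;
  act (fun _ => (Some true, true, tt)) ;; home.

(** One generous bound for all primitives: each makes a bounded number of passes over at most [Y]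
    blocks or [Y] output cells. *)
Definition cost Y := 8 * (B * Y.+2).

Lemma runs_reset w R L out j Y : j < m -> R j < L -> L <= Y ->
  runs (reset j) (cont w R L out, 1%Z) (cost Y) tt (cont w (updR R j 0) L out, 1%Z).
Proof.
move=> lt_jm lt_RL le_LY; set T := cont _ _ _ _.
(* No block has index [L]: this value stands for register [j] after its mark is erased. *)
pose R1 := updR R j L.
have T1 : upd T (pos (R j) j.+2) (Some false) = cont w R1 L out.
  rewrite -(@upd_cont_reg w R L out j (R j)) //.
    by rewrite (_ : (L == R j) = false) //; apply/negP => /eqP; lia.
  move=> i' ne_i lt_i'; rewrite eq_sym (negbTE ne_i).
  by apply/esym/negP => /eqP; lia.
have BLY : B * L <= B * Y by rewrite leq_mul2l le_LY orbT.
have L0 : 0 < L by lia.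
apply: (@runs_leq _ _ _ (B * L + ((B * R j + j.+1).+2 + (j.+2 + (1 + (B * 0 + j.+1).+2))))).
  have : B * (R j).+1 <= B * L by rewrite leq_mul2l lt_RL orbT.
  by rewrite /cost; lia.
apply: runs_bind (runs_find_reg _ _ _ _ lt_jm lt_RL) _; rewrite T1.
rewrite pos_shiftr // subn1 /=.
apply: runs_bind; first by apply: runs_home_pos => //; lia.
apply: runs_bind (runs_mvn _ _ _ _) _; rewrite -pos00 pos_shiftl add0n.
apply: runs_bind; first exact: runs_act.
rewrite pos_shiftr // subn1 /= pos00.
rewrite (_ : upd _ _ _ = cont w (updR R j 0) L out); first by apply: runs_home_pos => //; lia.
rewrite (_ : updR R j 0 = updR R1 j 0); last first.
  by apply: functional_extensionality => a; rewrite /R1 /updR; case: eqP.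
rewrite -(@upd_cont_reg w R1 L out j 0 0) // => i' ne_i' lt_i'.
rewrite /R1 /updR eqxx [0 == _]eq_sym (negbTE ne_i').
by apply/negP => /eqP; lia.
Qed.

Definition read d : frag bool := act (fun s => (s, d, s == Some true)).

Lemma runs_read d T p : runs (read d) (T, p) 1 (T p == Some true) (T, shiftn d 1 p).
Proof. exact: (@runs_act_id _ _ T). Qed.

Definition getbit q j : frag bool :=
  find j.+2 (Some true) true ;; mvn true (j.+1 - q) ;; b <~ read false ;; home ;; ret b.

Lemma runs_getbit q w R L out j Y : q < 2 -> j < m -> R j < L -> L <= Y ->
  runs (getbit q j) (cont w R L out, 1%Z) (cost Y) (cbit w R (R j) q)
    (cont w R L out, 1%Z).
Proof.
move=> lt_q lt_jm lt_RL le_LY; set T := cont _ _ _ _.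
have BLY : B * L <= B * Y by rewrite leq_mul2l le_LY orbT.
have -> : cbit w R (R j) q = (T (pos (R j) q) == Some true).
  by rewrite /T cont_pos ?lt_RL; [case: (cbit _ _ _ _) | lia].
apply: (@runs_leq _ _ _ (B * L + (j.+1 - q + (1 + ((B * R j + q.+1).+2 + 0))))).
  have : B * (R j).+1 <= B * L by rewrite leq_mul2l lt_RL orbT.
  by rewrite /cost; lia.
apply: runs_bind (runs_find_reg _ _ _ _ lt_jm lt_RL) _.
rewrite (_ : upd _ _ _ = T); last first.
  have TE : T (pos (R j) j.+2) = Some true by rewrite /T cont_pos // lt_RL /= eqxx.
  by rewrite -TE upd_id.
rewrite pos_shiftr // subn1 /=.
apply: runs_bind (runs_mvn _ _ _ _) _; rewrite pos_shiftr ?leq_subr // subKn; last by lia.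
apply: runs_bind; first exact: runs_read.
rewrite pos_shiftl addn1.
apply: runs_bind; first by apply: runs_home_pos => //; lia.
exact: runs_ret.
Qed.

(** The mark moves by [B] cells to the same offset of the next block. A blank found there means that
    the register outgrows the tape; then a new block is written in which only [j] is marked. *)
Definition inc j : frag unit :=
  find j.+2 (Some false) false ;; mvn false m.+1 ;;
  b <~ act (fun s => if s is None then (None, true, false) else (Some true, true, true)) ;;
  (if b then ret tt
   else mvn true j.+1 ;; wr [:: false, false & [seq i == j | i <- iota 0 m]] ;; mvn true 1) ;;
  home.

Lemma runs_inc w R L out j Y : j < m -> (forall i, i < m -> R i < L) -> L <= Y -> size w <= L ->
  (R j).+2 <= Y ->
  runs (inc j) (cont w R L out, 1%Z) (cost Y) tt
     (cont w (updR R j (R j).+1) (maxn L (R j).+2) out, 1%Z).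
Proof.
move=> lt_jm RL le_LY le_wL lt_RY; have lt_RL := RL _ lt_jm; set T := cont _ _ _ _.
(* This index is beyond all blocks even after one has been added, so it again stands for a missing
   mark. *)
pose R1 := updR R j L.+1.
have T1 : upd T (pos (R j) j.+2) (Some false) = cont w R1 L out.
  rewrite -(@upd_cont_reg w R L out j (R j)) //.
    by rewrite (_ : (L.+1 == R j) = false) //; apply/negP => /eqP; lia.
  move=> i' ne_i lt_i'; rewrite eq_sym (negbTE ne_i).
  by apply/esym/negP => /eqP; lia.
have BLY : B * L <= B * Y by rewrite leq_mul2l le_LY orbT.
have BRL : B * (R j).+1 <= B * L by rewrite leq_mul2l lt_RL orbT.
have updR1 : updR R j (R j).+1 = updR R1 j (R j).+1.
  by apply: functional_extensionality => a; rewrite /R1 /updR; case: eqP.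
apply: (@runs_leq _ _ _ (B * L + (m.+1 + (1 + ((j.+1 + (B + 1)) + (B * L + B).+3))))).
  by rewrite /cost; lia.
apply: runs_bind (runs_find_reg _ _ _ _ lt_jm lt_RL) _; rewrite T1 pos_shiftl.
apply: runs_bind (runs_mvn _ _ _ _) _.
rewrite pos_shiftl (_ : j.+2 + 1 + m.+1 = B + j.+2); last by lia.
rewrite posS.
have [lt_R1L|le_LR1] := ltnP (R j).+1 L.
  rewrite (maxn_idPl lt_R1L).
  apply: runs_bind.
    by apply: (@runs_act _ _ _ _ (Some true) true true); rewrite cont_pos // lt_R1L.
  rewrite (_ : upd _ _ _ = cont w (updR R j (R j).+1) L out); last first.
    rewrite updR1 -(@upd_cont_reg w R1 L out j (R j).+1) ?eqxx // => i' ne_i' lt_i'.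
    rewrite [_.+1 == i']eq_sym (negbTE ne_i') /R1 /updR eqxx.
    by apply/negP => /eqP; lia.
  apply: runs_bind; first by apply: (@runs_leq _ _ _ 0) => //; apply: runs_ret.
  rewrite pos_shiftr // subn1 /=.
  apply: (@runs_leq _ _ _ (B * (R j).+1 + j.+1).+2); first by lia.
  by apply: runs_home_pos => //; lia.
have LE : L = (R j).+1 by lia.
have sz : size [:: false, false & [seq i == j | i <- iota 0 m]] = B.
  by rewrite /= size_map size_iota.
rewrite (maxn_idPr (leqW le_LR1)).
apply: runs_bind.
  by apply: (@runs_act _ _ _ _ None true false); rewrite cont_pos // -LE ltnn.
rewrite (_ : upd _ _ _ = cont w R1 L out); last first.
  have TE : cont w R1 L out (pos (R j).+1 j.+2) = None by rewrite cont_pos // -LE ltnn.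
  by rewrite -TE upd_id.
rewrite pos_shiftr // subn1 /=.
apply: runs_bind.
  apply: runs_bind (runs_mvn _ _ _ _) _; rewrite pos_shiftr // subnn.
  rewrite addnC; apply: (@runs_leq _ _ _ (B + 1)); first by lia.
  rewrite -sz; apply: runs_bind (runs_wr _ _ _) _.
  exact: runs_mvn.
rewrite (_ : updl _ _ _ = cont w (updR R j (R j).+1) (R j).+2 out); last first.
  apply: cont_ext.
  - by rewrite updl_npos.
  - by move=> a; rewrite updl_npos ?cont_out //; lia.
  move=> a o lt_o; rewrite updl_pos // cont_pos // -LE.
  have [->|ne_a] := eqVneq a L.
    rewrite ltnS leqnn; congr Some.
    (* By [size w <= L] the new block lies past the input, so its two input bits are false; the
       other registers are below [L] and have no mark in it. *)
    case: o lt_o => [|[|o]] lt_o /=.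
    - by apply/esym/negP; lia.
    - by rewrite nth_default.
    rewrite (nth_map 0) ?size_iota ?nth_iota // add0n /updR.
    have [_|ne_o] := eqVneq o j; first by rewrite eqxx.
    by apply/esym/negP => /eqP; have := RL o; lia.
  rewrite (_ : (a < L.+1) = (a < L)); last by apply/idP/idP; lia.
  case: ifP => // lt_aL.
  case: o lt_o => [|[|o]] lt_o //=; rewrite /R1 /updR; have [_|//] := eqVneq o j.
  by congr Some; apply/idP/idP => /eqP; lia.
apply: (@runs_leq _ _ _ (B * (R j).+1 + m.+1).+2); first by lia.
rewrite (_ : shiftn true 1 _ = pos (R j).+1 m.+1); first by apply: runs_home_pos.
by rewrite sz -LE /shiftn /pos; lia.
Qed.

(** Both tracks are scanned in parallel; the first block that carries a mark of [i] or [j]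
    decides. *)
Definition ltreg i j : frag bool :=
  b <~ loop (mvn false i.+2 ;; b1 <~ read true ;; mvn true i.+1 ;;
             mvn false j.+2 ;; b2 <~ read true ;; mvn true j.+1 ;;
             if b1 then ret (Some (~~ b2))
             else if b2 then ret (Some false) else mvn false B ;; ret None) ;;
  home ;; ret b.

Lemma runs_ltreg w R L out i j Y : i < m -> j < m -> R i < L -> R j < L -> L <= Y ->
  runs (ltreg i j) (cont w R L out, 1%Z) (cost Y) (R i < R j) (cont w R L out, 1%Z).
Proof.
move=> lt_im lt_jm lt_RiL lt_RjL le_LY; set T := cont _ _ _ _.
pose mn := minn (R i) (R j).
have lt_mnL : mn < L by rewrite /mn; lia.
have BLY : B * L <= B * Y by rewrite leq_mul2l le_LY orbT.
have BmL : B * mn.+1 <= B * L by rewrite leq_mul2l lt_mnL orbT.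
apply: (@runs_leq _ _ _ (5 * B * mn.+1 + ((B * mn + 0).+2 + 0))); first by rewrite /cost; lia.
rewrite -pos00; apply: (@runs_bind _ _ _ _ _ _ (R i < R j) (T, pos mn 0)); last first.
  by rewrite pos00; apply: runs_bind; [apply: runs_home_pos | apply: runs_ret].
pose body : frag (option bool) :=
  mvn false i.+2 ;; b1 <~ read true ;; mvn true i.+1 ;;
  mvn false j.+2 ;; b2 <~ read true ;; mvn true j.+1 ;;
  if b1 then ret (Some (~~ b2))
  else if b2 then ret (Some false) else mvn false B ;; ret None.
have bodyP a n r tp : a < L ->
    runs (if R i == a then ret (Some (~~ (R j == a)))
          else if R j == a then ret (Some false) else mvn false B ;; ret None)
       (T, pos a 0) n r tp ->
    runs body (T, pos a 0) (4 * B + n) r tp.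
  move=> lt_aL run.
  apply: (@runs_leq _ _ _ (i.+2 + (1 + (i.+1 + (j.+2 + (1 + (j.+1 + n))))))); first by lia.
  apply: runs_bind (runs_mvn _ _ _ _) _; rewrite pos_shiftl add0n.
  apply: runs_bind; first exact: runs_read.
  rewrite pos_shiftr // subSS subn0.
  apply: runs_bind (runs_mvn _ _ _ _) _; rewrite pos_shiftr // subnn.
  apply: runs_bind (runs_mvn _ _ _ _) _; rewrite pos_shiftl add0n.
  apply: runs_bind; first exact: runs_read.
  rewrite pos_shiftr // subSS subn0.
  apply: runs_bind (runs_mvn _ _ _ _) _; rewrite pos_shiftr // subnn.
  rewrite /T !cont_pos // lt_aL.
  have SE (b : bool) : (Some b == Some true) = b by case: b.
  by rewrite !SE.
suff H n a : a + n = mn ->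
    runs (loop body) (T, pos a 0) (5 * B * n.+1) (R i < R j) (T, pos mn 0).
  by apply: H; rewrite add0n.
elim: n a => [|n IHn] a aE.
  rewrite addn0 in aE; apply: runs_loop_stop.
  rewrite muln1; apply: (@runs_leq _ _ _ (4 * B + 0)); first by lia.
  rewrite -aE in lt_mnL *; apply: bodyP => //.
  have [RiE|/eqP ne_i] := eqVneq (R i) a.
    rewrite (_ : ~~ _ = (R i < R j)); first exact: runs_ret.
    by apply/idP/idP; rewrite /mn in aE; lia.
  rewrite (_ : (R j == a) = true); last by apply/eqP; rewrite /mn in aE; lia.
  rewrite (_ : (R i < R j) = false); first exact: runs_ret.
  by apply/negP; rewrite /mn in aE; lia.
rewrite [_ * n.+2]mulnS; apply: (@runs_loop_again _ _ _ _ (T, pos a.+1 0)); last first.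
  by apply: IHn; lia.
apply: (@runs_leq _ _ _ (4 * B + (B + 0))); first by lia.
apply: bodyP; first by lia.
rewrite (_ : (R i == a) = false); last by apply/negP; rewrite /mn in aE; lia.
rewrite (_ : (R j == a) = false); last by apply/negP; rewrite /mn in aE; lia.
apply: runs_bind (runs_mvn _ _ _ _) _; rewrite pos_shiftl add0n -[B in pos a B]addn0 posS.
exact: runs_ret.
Qed.

Lemma cont_Some w R L out q : q < B * L -> cont w R L out (Z.of_nat q.+1) <> None.
Proof.
move=> lt_q; rewrite /cont; case: Z.eqb_spec => [|_]; first by lia.
by case: Z.ltb_spec; [lia | case: ifP => //; lia].
Qed.

Lemma upd0_None T : T 0%Z = None -> upd T 0 None = T.
Proof. by move=> <-; rewrite upd_id. Qed.

Lemma upd_neg_cont w R L out out' i x :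
  (forall a, onth out' a = if a == i then x else onth out a) ->
  upd (cont w R L out) (- Z.of_nat i.+1)%Z x = cont w R L out'.
Proof.
move=> outE; apply: cont_ext.
- by rewrite /upd; case: Z.eqb_spec => //; lia.
- move=> a; rewrite /upd outE cont_out; congr (if _ then _ else _).
  by apply/idP/idP => [/Z.eqb_spec|/eqP ->]; [lia | apply/Z.eqb_spec].
by move=> a o lt_o; rewrite /upd cont_pos.
Qed.

Definition emit b : frag unit :=
  mvn true 2 ;; skip true (Some b) false ;; skip false None false.

Lemma runs_emit w R L out b Y : size out <= Y ->
  runs (emit b) (cont w R L out, 1%Z) (cost Y) tt (cont w R L (rcons out b), 1%Z).
Proof.
move=> szY; set T := cont w R L out.
apply: (@runs_leq _ _ _ (2 + ((size out).+1 + (size out).+1))).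
  by rewrite /cost; nia.
apply: runs_bind (runs_mvn _ _ _ _) _.
have pE n : shiftn true n (shiftn true 2 1%Z) = (- Z.of_nat n.+1)%Z.
  by rewrite /shiftn; lia.
apply: runs_bind.
  apply: (@runs_skip _ _ _ (size out)) => [i lt_i|]; rewrite pE /T cont_out.
    by move=> e; have := onthTE out i; rewrite e lt_i.
  by rewrite onth_default.
rewrite pE (@upd_neg_cont _ _ _ _ (rcons out b)); last first.
  move=> a; rewrite -cats1 onth_cat.
  have [lt_a|le_a] := ltnP a (size out); first by rewrite ltn_eqF.
  have [->|ne_a] := eqVneq a (size out); first by rewrite subnn.
  by rewrite onth_default //= ?onth_default //; lia.
have p0 : shiftn false (size out) (shiftn false 1 (- Z.of_nat (size out).+1)) = 0%Z.
  by rewrite /shiftn; lia.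
have := @runs_skip false None false (size out) (cont w R L (rcons out b))
  (shiftn false 1 (- Z.of_nat (size out).+1)%Z).
rewrite p0 upd0_None //; apply=> //.
move=> i lt_i; rewrite (_ : shiftn _ _ _ = (- Z.of_nat (size out - i.+1).+1)%Z); last first.
  by rewrite /shiftn; lia.
rewrite cont_out => e; have := onthTE (rcons out b) (size out - i.+1).
by rewrite e size_rcons /=; lia.
Qed.

Definition append (s : seq bool) : frag unit :=
  skip false None true ;; mvn false 1 ;; wr s ;; mvn true 1.

Lemma runs_append T x s : size s = B ->
  (forall q, q < B * x -> T (Z.of_nat q.+1) <> None) -> T (pos x 0) = None ->
  runs (append s) (T, 1%Z) (B * x + B + 3) tt (updl T (pos x 0) s, pos x m.+1).
Proof.
move=> szs Tn T0.
apply: (@runs_leq _ _ _ ((B * x).+1 + (1 + (B + 1)))); first by lia.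
have pE : shiftn false (B * x) 1%Z = pos x 0 by rewrite /shiftn /pos; lia.
apply: runs_bind.
  apply: (@runs_skip _ _ _ (B * x)); last by rewrite pE.
  move=> i lt_i; rewrite (_ : shiftn _ _ _ = Z.of_nat i.+1); first exact: Tn.
  by rewrite /shiftn; lia.
rewrite pE -T0 upd_id; apply: runs_bind (runs_mvn _ _ _ _) _.
rewrite (_ : shiftn false 1 _ = pos x 0); last by rewrite /shiftn; lia.
rewrite -{1}szs; apply: runs_bind (runs_wr _ _ _) _.
rewrite szs (_ : pos x m.+1 = shiftn true 1 (shiftn false B (pos x 0))).
  exact: runs_mvn.
by rewrite /shiftn /pos; lia.
Qed.

(** The cell just read is blanked as a bookmark. After the new block is appended at the far left,
    the run to the right stops at this blank, restores the bit and moves to the next one. *)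
Definition load_step : frag (option unit) :=
  s <~ act (fun s => (None, false, s)) ;;
  if s is Some b then
    skip false None false ;; append [:: true, b & nseq m false] ;;
    skip true None true ;; skip true (Some b) true ;; ret None
  else ret (Some tt).

(** The input is erased once it is copied, since the output will use its cells. While copying, all
    registers are regarded as having value [size w], so no block carries a mark; the extra last
    block then supplies all marks. *)
Definition load : frag unit :=
  loop load_step ;;
  loop (act (fun s => (None, false, if s is Some _ then None else Some tt))) ;;
  append [:: false, false & nseq m true] ;; home.

Lemma runs_load_bit w x : x < size w ->
  runs (skip false None false ;; append [:: true, nth false w x & nseq m false] ;;
        skip true None true ;; skip true (Some (nth false w x)) true ;; ret (@None unit))
    (upd (cont w (fun=> size w) x w) (- Z.of_nat x.+1)%Z None, (- Z.of_nat x)%Z)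
    (4 * (B * (size w).+2)) None (cont w (fun=> size w) x.+1 w, (- Z.of_nat x.+2)%Z).
Proof.
move=> lt_x; set T := upd _ _ _; set b := nth false w x.
have szs : size [:: true, b & nseq m false] = B by rewrite /= size_nseq.
have Tpos (p : Z) : (0 <= p)%Z -> T p = cont w (fun=> size w) x w p.
  by move=> p_ge; rewrite /T /upd; case: Z.eqb_spec => //; lia.
have Tneg i : T (- Z.of_nat i.+1)%Z = if i == x then None else onth w i.
  rewrite /T /upd cont_out; congr (if _ then _ else _).
  by apply/idP/idP => [/Z.eqb_spec|/eqP ->]; [lia | apply/Z.eqb_spec].
have wS i : i < x -> onth w i <> None.
  by move=> lt_i e; have := onthTE w i; rewrite e (ltn_trans lt_i lt_x).
set s := [:: _, _ & _] in szs *; pose T1 := updl T (pos x 0) s.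
have T1neg i : T1 (- Z.of_nat i.+1)%Z = if i == x then None else onth w i.
  by rewrite /T1 updl_npos ?Tneg //; lia.
have BxN : B * x.+1 <= B * size w by rewrite leq_mul2l lt_x orbT.
apply: (@runs_leq _ _ _ (x.+1 + ((B * x + B + 3) + ((B * x + B).+1 + (x.+1 + 0))))); first by nia.
have p0 : shiftn false x (- Z.of_nat x)%Z = 0%Z by rewrite /shiftn; lia.
apply: runs_bind.
  apply: (@runs_skip _ _ _ x); last by rewrite p0 Tpos.
  move=> i lt_i; rewrite (_ : shiftn _ _ _ = (- Z.of_nat (x - i.+1).+1)%Z).
    by rewrite Tneg ifN; [apply: wS; lia | apply/eqP; lia].
  by rewrite /shiftn; lia.
rewrite p0 upd0_None; last by rewrite Tpos.
apply: runs_bind.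
  apply: (@runs_append _ x) => //.
    by move=> q lt_q; rewrite Tpos; [apply: cont_Some | lia].
  by rewrite Tpos ?cont_pos ?ltnn // /pos; lia.
rewrite -/T1.
have p1 : shiftn true (B * x + B) (pos x m.+1) = 0%Z by rewrite /shiftn /pos; lia.
have T10 : T1 0%Z = None by rewrite /T1 updl_npos // Tpos.
apply: runs_bind.
  apply: (@runs_skip _ _ _ (B * x + B)); last by rewrite p1.
  move=> q lt_q; rewrite (_ : shiftn _ _ _ = Z.of_nat (B * x + B - q)); last first.
    by rewrite /shiftn /pos; lia.
  rewrite /T1 /updl; case: ifP => // /negbT cond.
  rewrite Tpos; last by lia.
  have -> : B * x + B - q = (B * x + B - q).-1.+1 by lia.
  apply: cont_Some; move: cond; rewrite szs /pos; lia.
rewrite p1 upd0_None //.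
have pE n : shiftn true n (shiftn true 1 0%Z) = (- Z.of_nat n.+1)%Z by rewrite /shiftn; lia.
apply: runs_bind.
  apply: (@runs_skip _ _ _ x); last by rewrite pE T1neg eqxx.
  by move=> i lt_i; rewrite pE T1neg ltn_eqF //; apply: wS.
rewrite pE (_ : upd _ _ _ = cont w (fun=> size w) x.+1 w).
  rewrite (_ : shiftn _ _ _ = - Z.of_nat x.+2)%Z; first exact: runs_ret.
  by rewrite /shiftn; lia.
apply: cont_ext.
- by rewrite /upd; case: Z.eqb_spec => //; lia.
- move=> i; rewrite /upd; case: Z.eqb_spec => [e|ne].
    have -> : i = x by lia.
    by rewrite onthE (nth_map false).
  by rewrite T1neg ifN //; apply/eqP; lia.
move=> i o lt_o; rewrite /upd; case: Z.eqb_spec => [|_]; first by rewrite /pos; lia.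
rewrite /T1 updl_pos // Tpos; last by rewrite /pos; lia.
rewrite cont_pos //; have [->|ne_i] := eqVneq i x.
  rewrite leqnn; congr Some; case: o lt_o => [|[|o]] lt_o /=.
  - by rewrite lt_x.
  - by [].
  by rewrite nth_nseq; case: ifP => _; apply/esym/negP; lia.
by rewrite (_ : (i < x.+1) = (i < x)) //; apply/idP/idP; lia.
Qed.

Lemma runs_load w :
  runs load (word_tape w, (-1)%Z) ((size w).+3 * cost (size w)) tt
    (cont w (fun=> size w) (size w).+1 [::], 1%Z).
Proof.
set N := size w; pose R := fun _ : nat => N.
(* Without any block, the initial tape has the shape of a work tape whose output area holds the
   input. *)
have -> : word_tape w = cont w R 0 w.
  apply: cont_ext => // i.
  by rewrite /word_tape; case: Z.ltb_spec; [move=> _; congr onth; lia | lia].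
apply: (@runs_leq _ _ _ (N.+1 * cost N + (N.+1 + (B * N + B + 3 + (B * N + m.+1).+2)))).
  by rewrite /cost; nia.
apply: runs_bind.
  suff H n x : x + n = N -> runs (loop load_step) (cont w R x w, (- Z.of_nat x.+1)%Z)
      (n.+1 * cost N) tt (cont w R N w, (- Z.of_nat N)%Z) by apply: (H N 0).
  elim: n x => [|n IHn] x xE.
    rewrite addn0 in xE; rewrite xE mul1n; apply: runs_loop_stop.
    apply: (@runs_leq _ _ _ (1 + 0)); first by rewrite /cost; lia.
    apply: runs_bind.
      by apply: (@runs_act_id _ _ _ _ false None); rewrite cont_out onth_default.
    rewrite (_ : shiftn _ _ _ = - Z.of_nat N)%Z; first exact: runs_ret.
    by rewrite /shiftn; lia.
  rewrite mulSn; apply: (@runs_loop_again _ _ _ _ (cont w R x.+1 w, (- Z.of_nat x.+2)%Z)).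
    apply: (@runs_leq _ _ _ (1 + 4 * (B * N.+2))); first by rewrite /cost; lia.
    apply: runs_bind; first exact: runs_act.
    have -> : shiftn false 1 (- Z.of_nat x.+1) = (- Z.of_nat x)%Z by rewrite /shiftn; lia.
    rewrite cont_out onthE (nth_map false); last by rewrite -/N; lia.
    by apply: runs_load_bit; rewrite -/N; lia.
  by apply: IHn; lia.
apply: runs_bind.
  have H L : forall v,
    runs (loop (act (fun s => (None, false, if s is Some _ then None else Some tt))))
      (cont w R L v, (- Z.of_nat (size v))%Z) (size v).+1 tt (cont w R L [::], 1%Z).
    elim/last_ind => [|v b IHv].
      apply: runs_loop_stop.
      exact: (@runs_act_id _ _ (cont w R L [::]) 0%Z false (Some tt)).
    rewrite size_rcons -[(size v).+2]add1n; apply: (runs_loop_again _ IHv).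
    have -> : (- Z.of_nat (size v))%Z = shiftn false 1 (- Z.of_nat (size v).+1).
      by rewrite /shiftn; lia.
    rewrite -(@upd_neg_cont w R L (rcons v b) v (size v) None).
      apply: runs_act; rewrite cont_out -cats1 onth_cat ltnn subnn //.
    move=> a; rewrite -cats1 onth_cat.
    have [lt_a|le_a] := ltnP a (size v); first by rewrite ltn_eqF.
    rewrite onth_default //; case: eqP => // ne_a.
    by rewrite onth_default //=; lia.
  exact: H.
have szs : size [:: false, false & nseq m true] = B by rewrite /= size_nseq.
apply: runs_bind.
  apply: (@runs_append _ N) => //; first by move=> q; apply: cont_Some.
  by rewrite cont_pos // ltnn.
rewrite (_ : updl _ _ _ = cont w R N.+1 [::]); first by apply: runs_home_pos.
apply: cont_ext.
- by rewrite updl_npos.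
- by move=> i; rewrite updl_npos ?cont_out //; lia.
move=> i o lt_o; rewrite updl_pos // cont_pos //.
have [->|ne_i] := eqVneq i N.
  rewrite leqnn; congr Some; case: o lt_o => [|[|o]] lt_o /=.
  - by rewrite ltnn.
  - by rewrite nth_default.
  by rewrite nth_nseq eqxx; case: ifP => //; lia.
by rewrite (_ : (i < N.+1) = (i < N)) //; apply/idP/idP; lia.
Qed.

End Prims.

(** * Loop programs *)

(** One constant as both shift and exponent: closure under sum, product and composition then follows
    from monotonicity. The form of [poly_time_computable] is reached only at the end, by
    [poly_boundedP]. *)
Definition poly_bounded (f : nat -> nat) := exists c, forall x, f x <= (x + c) ^ c.

Lemma poly_bounded_leq f g : (forall x, f x <= g x) -> poly_bounded g -> poly_bounded f.
Proof. by move=> le_fg [c gc]; exists c => x; apply: leq_trans (gc x). Qed.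

Lemma poly_bounded_const a : poly_bounded (fun=> a).
Proof.
exists a.+1 => x; apply: (@leq_trans ((x + a.+1) ^ 1)).
  by rewrite expn1; lia.
by apply: leq_pexp2l; lia.
Qed.

Lemma poly_bounded_id : poly_bounded id.
Proof. by exists 1 => x; rewrite expn1; lia. Qed.

Lemma leq_wexp2r a b n : a <= b -> a ^ n <= b ^ n.
Proof. by case: n => // n; rewrite leq_exp2r. Qed.

Lemma poly_bounded_add f g :
  poly_bounded f -> poly_bounded g -> poly_bounded (fun x => f x + g x).
Proof.
move=> [a fa] [b gb]; exists (a + b).+2 => x.
apply: (@leq_trans (2 * (x + (a + b).+2) ^ (a + b))).
  rewrite mul2n -addnn; apply: leq_add.
    apply: leq_trans (fa x) _; apply: (@leq_trans ((x + (a + b).+2) ^ a)).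
      by apply: leq_wexp2r; lia.
    by apply: leq_pexp2l; lia.
  apply: leq_trans (gb x) _; apply: (@leq_trans ((x + (a + b).+2) ^ b)).
    by apply: leq_wexp2r; lia.
  by apply: leq_pexp2l; lia.
rewrite (expnS _ (a + b).+1) leq_mul //; first by lia.
by apply: leq_pexp2l; lia.
Qed.

Lemma poly_bounded_mul f g :
  poly_bounded f -> poly_bounded g -> poly_bounded (fun x => f x * g x).
Proof.
move=> [a fa] [b gb]; exists (a + b) => x; rewrite expnD leq_mul //.
  by apply: leq_trans (fa x) _; apply: leq_wexp2r; lia.
by apply: leq_trans (gb x) _; apply: leq_wexp2r; lia.
Qed.

Lemma poly_bounded_comp f g :
  poly_bounded f -> poly_bounded g -> poly_bounded (fun x => f (g x)).
Proof.
move=> [a fa] g_poly.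
have [b gb] := poly_bounded_add g_poly (poly_bounded_const a).
exists (b * a + b) => x; apply: leq_trans (fa _) _.
apply: leq_trans (leq_wexp2r a (gb x)) _; rewrite -expnM.
apply: (@leq_trans ((x + (b * a + b)) ^ (b * a))).
  by apply: leq_wexp2r; lia.
have [->|b0] := posnP b; first by rewrite mul0n.
by apply: leq_pexp2l; lia.
Qed.

Lemma poly_boundedP f : poly_bounded f -> exists c, forall x, f x <= c * x ^ c + c.
Proof.
move=> [c fc]; exists (c.+1 ^ c + c) => x; apply: leq_trans (fc x) _.
(* At [x = 0] the monomial may vanish, and the additive constant has to absorb [c ^ c]. *)
have [->|x0] := posnP x.
  by rewrite add0n; apply: (@leq_trans (c.+1 ^ c)); [apply: leq_wexp2r | lia].
apply: (@leq_trans ((c.+1 * x) ^ c)); first by apply: leq_wexp2r; nia.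
rewrite expnMn; apply: (@leq_trans (c.+1 ^ c * x ^ (c.+1 ^ c + c))).
  by rewrite leq_mul2l leq_pexp2l ?orbT //; lia.
by rewrite mulnDl; lia.
Qed.

(** * Time-bounded register runs, with the tape length hidden *)

Section Registers.
Variables (m : nat) (w : seq bool) (Y : nat).
Notation N := (size w).

(* One unit of [q] pays for one primitive operation. *)
Variant reg_runs (E : finType) (M : frag E) R out q e R' out' : Prop :=
  RegRuns of forall L, N < L -> L <= Y -> (forall i, i < m -> R i < L) ->
  exists L', [/\ L <= L', L' <= Y, forall i, i < m -> R' i < L' &
    runs M (cont m w R L out, 1%Z) (q * cost m Y) e (cont m w R' L' out', 1%Z)].

Lemma reg_runs_leq (E : finType) (M : frag E) R out q q' e R' out' :
  q <= q' -> reg_runs M R out q e R' out' -> reg_runs M R out q' e R' out'.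
Proof.
move=> le_q [run]; split=> L NL LY RL; have [L' [? ? ? run']] := run L NL LY RL.
by exists L'; split=> //; apply: runs_leq run'; rewrite leq_mul2r le_q orbT.
Qed.

(** Any admissible tape length [L <= Y] exceeds the input length and all registers, so these bounds
    by [Y] may be assumed while the cost is being estimated. *)
Lemma reg_runs_bound (E : finType) (M : frag E) R out q e R' out' :
  (N < Y -> (forall i, i < m -> R i < Y) -> reg_runs M R out q e R' out') ->
  reg_runs M R out q e R' out'.
Proof.
move=> H; split=> L NL LY RL.
have RY i : i < m -> R i < Y by move=> lt_i; apply: leq_trans (RL i lt_i) LY.
by have [run] := H (leq_trans NL LY) RY; apply: run.
Qed.

Lemma reg_runs_ret (E : finType) (e : E) R out : reg_runs (ret e) R out 0 e R out.
Proof. by split=> L NL LY RL; exists L; split=> //; apply: runs_ret. Qed.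

Lemma reg_runs_bind (E E' : finType) (M : frag E) (K : E -> frag E') R out q e R1 out1 q' e' R2 out2 :
  reg_runs M R out q e R1 out1 -> reg_runs (K e) R1 out1 q' e' R2 out2 ->
  reg_runs (bind M K) R out (q + q') e' R2 out2.
Proof.
move=> [run1] [run2]; split=> L NL LY RL; have [L1 [LL1 L1Y RL1 r1]] := run1 L NL LY RL.
have [L2 [L12 L2Y RL2 r2]] := run2 L1 (leq_trans NL LL1) L1Y RL1.
exists L2; split=> //; first exact: leq_trans L12.
by rewrite mulnDl; apply: runs_bind r1 r2.
Qed.

Lemma reg_runs_loop_stop (E : finType) (M : frag (option E)) R out q e R' out' :
  reg_runs M R out q (Some e) R' out' -> reg_runs (loop M) R out q e R' out'.
Proof.
move=> [run]; split=> L NL LY RL; have [L1 [? ? ? r1]] := run L NL LY RL.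
by exists L1; split=> //; apply: runs_loop_stop.
Qed.

Lemma reg_runs_loop_again (E : finType) (M : frag (option E)) R out q R1 out1 q' e R2 out2 :
  reg_runs M R out q None R1 out1 -> reg_runs (loop M) R1 out1 q' e R2 out2 ->
  reg_runs (loop M) R out (q + q') e R2 out2.
Proof.
move=> [run1] [run2]; split=> L NL LY RL; have [L1 [LL1 L1Y RL1 r1]] := run1 L NL LY RL.
have [L2 [L12 L2Y RL2 r2]] := run2 L1 (leq_trans NL LL1) L1Y RL1.
exists L2; split=> //; first exact: leq_trans L12.
by rewrite mulnDl; apply: runs_loop_again r1 r2.
Qed.

Lemma reg_runs_reset R out j : j < m -> reg_runs (reset m j) R out 1 tt (updR R j 0) out.
Proof.
move=> lt_j; split=> L NL LY RL; exists L; split=> //.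
  by move=> i lt_i; rewrite /updR; case: eqP => _; [lia | apply: RL].
by rewrite mul1n; apply: runs_reset => //; apply: RL.
Qed.

Lemma reg_runs_inc R out j : j < m -> (R j).+2 <= Y ->
  reg_runs (inc m j) R out 1 tt (updR R j (R j).+1) out.
Proof.
move=> lt_j RY; split=> L NL LY RL; exists (maxn L (R j).+2); split.
- exact: leq_maxl.
- by rewrite geq_max LY.
- move=> i lt_i; rewrite /updR leq_max; case: eqP => _; first by rewrite leqnn orbT.
  by rewrite RL.
by rewrite mul1n; apply: runs_inc => //; lia.
Qed.

Lemma reg_runs_valid R out j : j < m -> reg_runs (getbit m 0 j) R out 1 (R j < N) R out.
Proof.
move=> lt_j; split=> L NL LY RL; exists L; split=> //; rewrite mul1n.
by apply: (@runs_getbit m 0 w) => //; apply: RL.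
Qed.

Lemma reg_runs_bit R out j : j < m -> reg_runs (getbit m 1 j) R out 1 (nth false w (R j)) R out.
Proof.
move=> lt_j; split=> L NL LY RL; exists L; split=> //; rewrite mul1n.
by apply: (@runs_getbit m 1 w) => //; apply: RL.
Qed.

Lemma reg_runs_lt R out i j : i < m -> j < m -> reg_runs (ltreg m i j) R out 1 (R i < R j) R out.
Proof.
move=> lt_i lt_j; split=> L NL LY RL; exists L; split=> //; rewrite mul1n.
by apply: runs_ltreg => //; apply: RL.
Qed.

Lemma reg_runs_emit R out b : size out <= Y -> reg_runs (emit b) R out 1 tt R (rcons out b).
Proof.
move=> szY; split=> L NL LY RL; exists L; split=> //; rewrite mul1n.
exact: runs_emit.
Qed.

Lemma updRR R j a b : updR (updR R j a) j b = updR R j b.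
Proof. by apply: functional_extensionality => i; rewrite /updR; case: eqP. Qed.

Lemma updR_id R j : updR R j (R j) = R.
Proof. by apply: functional_extensionality => i; rewrite /updR; case: eqP => [->|]. Qed.

Lemma updR_eq R j a : updR R j a j = a.
Proof. by rewrite /updR eqxx. Qed.

Lemma updR_ne R j a i : i != j -> updR R j a i = R i.
Proof. by rewrite /updR => /negbTE ->. Qed.

Lemma updRC R i j a b : i != j -> updR (updR R i a) j b = updR (updR R j b) i a.
Proof.
move=> ne_ij; apply: functional_extensionality => l; rewrite /updR.
by case: eqP => [->|//]; rewrite eq_sym (negbTE ne_ij).
Qed.

(** Registers can be reset, incremented and compared, but not decremented, so arithmetic is done by
    counting up to a comparison. *)
Definition copy s v : frag unit :=
  reset m s ;;
  loop (b <~ ltreg m s v ;; if b then inc m s ;; ret None else ret (Some tt)).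

Lemma reg_runs_copy R out s v : s < m -> v < m -> s != v ->
  reg_runs (copy s v) R out (2 * Y + 2) tt (updR R s (R v)) out.
Proof.
move=> lt_s lt_v ne_sv; apply: reg_runs_bound => NY RY.
have RvY := RY v lt_v.
apply: (@reg_runs_leq _ _ _ _ (1 + (2 * R v + 1))); first by lia.
apply: reg_runs_bind (reg_runs_reset _ _ lt_s) _.
suff H n x : x + n = R v ->
    reg_runs (loop (b <~ ltreg m s v ;; if b then inc m s ;; ret None else ret (Some tt)))
      (updR R s x) out (2 * n + 1) tt (updR R s (R v)) out by apply: H.
elim: n x => [|n IHn] x xE.
  apply: reg_runs_loop_stop; rewrite -[2 * 0 + 1]/(1 + 0).
  apply: reg_runs_bind; first exact: reg_runs_lt.
  rewrite updR_eq updR_ne 1?eq_sym // -xE addn0 ltnn.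
  exact: reg_runs_ret.
rewrite (_ : 2 * n.+1 + 1 = (1 + (1 + 0)) + (2 * n + 1)); last by lia.
apply: reg_runs_loop_again; last by apply: (IHn x.+1); lia.
apply: reg_runs_bind; first exact: reg_runs_lt.
rewrite updR_eq updR_ne 1?eq_sym // (_ : x < R v); last by lia.
apply: reg_runs_bind; last exact: reg_runs_ret.
by have := @reg_runs_inc (updR R s x) out s lt_s; rewrite updR_eq updRR; apply; lia.
Qed.

Definition addto s a c : frag unit :=
  reset m c ;;
  loop (b <~ ltreg m c a ;; if b then inc m s ;; inc m c ;; ret None else ret (Some tt)).

Lemma reg_runs_addto R out s a c : s < m -> a < m -> c < m -> s != a -> s != c -> a != c ->
  R s + R a < Y ->
  reg_runs (addto s a c) R out (3 * Y + 2) tt (updR (updR R s (R s + R a)) c (R a)) out.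
Proof.
move=> lt_s lt_a lt_c ne_sa ne_sc ne_ac RY; apply: reg_runs_bound => NY RiY.
apply: (@reg_runs_leq _ _ _ _ (1 + (3 * R a + 1))); first by lia.
apply: reg_runs_bind (reg_runs_reset _ _ lt_c) _.
suff H n x : x + n = R a ->
    reg_runs (loop (b <~ ltreg m c a ;; if b then inc m s ;; inc m c ;; ret None else ret (Some tt)))
      (updR (updR R s (R s + x)) c x) out (3 * n + 1) tt
      (updR (updR R s (R s + R a)) c (R a)) out.
  by have := H (R a) 0 (add0n _); rewrite addn0 updR_id.
elim: n x => [|n IHn] x xE.
  apply: reg_runs_loop_stop; rewrite -[3 * 0 + 1]/(1 + 0).
  apply: reg_runs_bind; first exact: reg_runs_lt.
  rewrite updR_eq updR_ne // updR_ne 1?eq_sym // -xE addn0 ltnn.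
  exact: reg_runs_ret.
rewrite (_ : 3 * n.+1 + 1 = (1 + (1 + (1 + 0))) + (3 * n + 1)); last by lia.
apply: reg_runs_loop_again; last by apply: (IHn x.+1); lia.
apply: reg_runs_bind; first exact: reg_runs_lt.
rewrite updR_eq updR_ne // updR_ne 1?eq_sym // (_ : x < R a); last by lia.
set R1 := updR _ c x.
have R1s : R1 s = R s + x by rewrite /R1 updR_ne // updR_eq.
have R1c : R1 c = x by rewrite /R1 updR_eq.
apply: reg_runs_bind; first by apply: reg_runs_inc => //; rewrite R1s; lia.
apply: reg_runs_bind.
  by apply: reg_runs_inc => //; rewrite updR_ne 1?eq_sym // R1c; have := RiY a lt_a; lia.
rewrite updR_ne 1?eq_sym // R1c R1s (_ : updR _ c x.+1 = updR (updR R s (R s + x.+1)) c x.+1).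
  exact: reg_runs_ret.
by rewrite /R1 (updRC _ _ _ (i := c)) 1?eq_sym // !updRR addnS.
Qed.

(** The second test stops [u] at the end of the input. This is the cap that keeps the values of
    [ERec] polynomial. *)
Definition copymin u s : frag unit :=
  reset m u ;;
  loop (b <~ ltreg m u s ;; b' <~ getbit m 0 u ;;
        if b && b' then inc m u ;; ret None else ret (Some tt)).

Lemma reg_runs_copymin R out u s : u < m -> s < m -> u != s ->
  reg_runs (copymin u s) R out (3 * Y + 3) tt (updR R u (minn N (R s))) out.
Proof.
move=> lt_u lt_s ne_us; apply: reg_runs_bound => NY RY.
have RsY := RY s lt_s; set M := minn N (R s).
apply: (@reg_runs_leq _ _ _ _ (1 + (3 * M + 2))); first by rewrite /M; lia.
apply: reg_runs_bind (reg_runs_reset _ _ lt_u) _.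
suff H n x : x + n = M ->
    reg_runs (loop (b <~ ltreg m u s ;; b' <~ getbit m 0 u ;;
              if b && b' then inc m u ;; ret None else ret (Some tt)))
      (updR R u x) out (3 * n + 2) tt (updR R u M) out by apply: H.
elim: n x => [|n IHn] x xE.
  apply: reg_runs_loop_stop; rewrite -[3 * 0 + 2]/(1 + (1 + 0)).
  apply: reg_runs_bind; first exact: reg_runs_lt.
  apply: reg_runs_bind; first exact: reg_runs_valid.
  rewrite updR_eq updR_ne 1?eq_sym // (_ : _ && _ = false).
    by rewrite -xE addn0; apply: reg_runs_ret.
  by rewrite /M in xE; apply/negP; lia.
rewrite (_ : 3 * n.+1 + 2 = (1 + (1 + (1 + 0))) + (3 * n + 2)); last by lia.
apply: reg_runs_loop_again; last by apply: (IHn x.+1); lia.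
apply: reg_runs_bind; first exact: reg_runs_lt.
apply: reg_runs_bind; first exact: reg_runs_valid.
rewrite updR_eq updR_ne 1?eq_sym // (_ : _ && _ = true); last first.
  by rewrite /M in xE; lia.
apply: reg_runs_bind; last exact: reg_runs_ret.
have := @reg_runs_inc (updR R u x) out u lt_u; rewrite updR_eq updRR; apply.
by rewrite /M in xE; lia.
Qed.

Definition for_reg v (body : frag unit) : frag unit :=
  reset m v ;;
  loop (b <~ getbit m 0 v ;; if b then body ;; inc m v ;; ret None else ret (Some tt)).

(** [Inv x] describes the state after [x] passes. The body may overwrite every register as long as
    [v] is back to [x] at its end; the final registers are existential because temporaries are
    overwritten. *)
Lemma reg_runs_for_reg v body q (Inv : nat -> (nat -> nat) -> seq bool -> Prop) R out :
  v < m -> Inv 0 (updR R v 0) out ->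
  (forall x R1 out1, x < N -> Inv x R1 out1 -> R1 v = x -> exists R2 out2,
     [/\ reg_runs body R1 out1 q tt R2 out2, R2 v = x & Inv x.+1 (updR R2 v x.+1) out2]) ->
  N < Y ->
  exists R' out', reg_runs (for_reg v body) R out (2 + Y * (q + 2)) tt R' out' /\ Inv N R' out'.
Proof.
move=> lt_v Inv0 InvS NY.
suff H n x R1 out1 : x + n = N -> Inv x R1 out1 -> R1 v = x -> exists R' out',
   reg_runs (loop (b <~ getbit m 0 v ;; if b then body ;; inc m v ;; ret None else ret (Some tt)))
      R1 out1 (1 + n * (q + 2)) tt R' out' /\ Inv N R' out'.
  have [R' [out' [run InvN]]] := H N 0 _ _ (add0n _) Inv0 (updR_eq _ _ _).
  exists R', out'; split=> //.
  apply: (@reg_runs_leq _ _ _ _ (1 + (1 + N * (q + 2)))).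
    by rewrite addnA leq_add2l leq_mul2r ltnW ?orbT.
  by apply: reg_runs_bind run; apply: reg_runs_reset.
elim: n x R1 out1 => [|n IHn] x R1 out1 xE Invx R1v.
  rewrite addn0 in xE; rewrite xE in R1v Invx; exists R1, out1; split=> //.
  apply: reg_runs_loop_stop; rewrite -[1 + _]/(1 + 0); apply: reg_runs_bind; first exact: reg_runs_valid.
  by rewrite R1v ltnn; apply: reg_runs_ret.
have lt_x : x < N by lia.
have [R2 [out2 [run R2v InvSx]]] := InvS x R1 out1 lt_x Invx R1v.
have [R' [out' [run' InvN]]] :=
  IHn x.+1 _ _ (esym (eq_trans (esym xE) (addnS x n))) InvSx (updR_eq _ _ _).
exists R', out'; split=> //.
rewrite (_ : 1 + n.+1 * (q + 2) = (1 + (q + (1 + 0))) + (1 + n * (q + 2)));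
  last by rewrite mulSn; lia.
apply: reg_runs_loop_again run'; apply: reg_runs_bind; first exact: reg_runs_valid.
rewrite R1v lt_x; apply: reg_runs_bind run _; apply: reg_runs_bind; last exact: reg_runs_ret.
by have := @reg_runs_inc R2 out2 v lt_v; rewrite R2v; apply; lia.
Qed.

End Registers.

(* Natural-number expressions over an input word [w]: [ESum v e] sums over the
   positions of [w], and [ERec u v e] iterates [u := min (size w) e] from [u = 1]
   with [v] running over these positions. *)
Inductive exp :=
  | EVar of nat
  | EOne
  | EAdd of exp & exp
  | ELt of exp & exp
  | EBit of exp
  | EIf of exp & exp & exp
  | ESum of nat & exp
  | ERec of nat & nat & exp.

Fixpoint eval (w : seq bool) (env : nat -> nat) (e : exp) : nat :=
  match e with
  | EVar v => env v
  | EOne => 1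
  | EAdd e1 e2 => eval w env e1 + eval w env e2
  | ELt e1 e2 => eval w env e1 < eval w env e2
  | EBit e1 => nth false w (eval w env e1)
  | EIf e0 e1 e2 => if 0 < eval w env e0 then eval w env e1 else eval w env e2
  | ESum v e1 => \sum_(i < size w) eval w (updR env v i) e1
  | ERec u v e1 =>
    iteri (size w) (fun i a => minn (size w) (eval w (updR (updR env u a) v i) e1)) 1
  end.

(* Binders are named by their depth. *)
Fixpoint wf (d : nat) (e : exp) : bool :=
  match e with
  | EVar v => v < d
  | EOne => true
  | EAdd e1 e2 | ELt e1 e2 => wf d e1 && wf d e2
  | EBit e1 => wf d e1
  | EIf e0 e1 e2 => [&& wf d e0, wf d e1 & wf d e2]
  | ESum v e1 => (v == d) && wf d.+1 e1
  | ERec u v e1 => [&& u == d, v == d.+1 & wf d.+2 e1]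
  end.

(** A crude upper bound, with sums in place of maxima: all bound variables have their registers
    below it. *)
Fixpoint binders (e : exp) : nat :=
  match e with
  | EVar _ | EOne => 0
  | EAdd e1 e2 | ELt e1 e2 => binders e1 + binders e2
  | EBit e1 => binders e1
  | EIf e0 e1 e2 => binders e0 + binders e1 + binders e2
  | ESum v e1 => v.+1 + binders e1
  | ERec u v e1 => u.+1 + v.+1 + binders e1
  end.

Fixpoint temps (e : exp) : nat :=
  match e with
  | EVar _ | EOne => 1
  | EAdd e1 e2 | ELt e1 e2 => temps e1 + temps e2 + 3
  | EBit e1 => temps e1 + 1
  | EIf e0 e1 e2 => temps e0 + temps e1 + temps e2 + 2
  | ESum v e1 | ERec _ v e1 => temps e1 + 3
  end.

(** Polynomial in [X] for each fixed [e]. [ERec] contributes only [X] thanks to its cap at the word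
    length; uncapped iteration could double a value at each position. *)
Fixpoint vbound (e : exp) (X : nat) : nat :=
  match e with
  | EVar v => X
  | EOne | ELt _ _ | EBit _ => 1
  | EAdd e1 e2 | EIf _ e1 e2 => vbound e1 X + vbound e2 X
  | ESum v e1 => X * vbound e1 X
  | ERec u v e1 => X
  end.

(** Bounds the tape length needed. The additive margins are due to [inc], which takes a register
    with value [r] to a tape of at least [r.+2] blocks. *)
Fixpoint sbound (e : exp) (X : nat) : nat :=
  match e with
  | EVar v => X.+2
  | EOne => 3
  | EAdd e1 e2 => sbound e1 X + sbound e2 X + vbound e1 X + vbound e2 X + 1
  | ELt e1 e2 => sbound e1 X + sbound e2 X + 3
  | EBit e1 => sbound e1 X + 3
  | EIf e0 e1 e2 => sbound e0 X + sbound e1 X + sbound e2 X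
  | ESum v e1 => sbound e1 X + X * vbound e1 X + vbound e1 X + X.+2
  | ERec u v e1 => sbound e1 X + X.+3
  end.

Fixpoint tbound (e : exp) (Y : nat) : nat :=
  match e with
  | EVar v => 2 * Y + 2
  | EOne => 2
  | EAdd e1 e2 => tbound e1 Y + tbound e2 Y + (3 * Y + 2)
  | ELt e1 e2 => tbound e1 Y + tbound e2 Y + 3
  | EBit e1 => tbound e1 Y + 3
  | EIf e0 e1 e2 => tbound e0 Y + tbound e1 Y + tbound e2 Y + 2
  | ESum v e1 => 3 + Y * (tbound e1 Y + (3 * Y + 2) + 2)
  | ERec u v e1 => 4 + Y * (tbound e1 Y + (3 * Y + 3) + 2) + (2 * Y + 2)
  end.

Lemma eval_ext w d e env env' : wf d e -> (forall i, i < d -> env i = env' i) ->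
  eval w env e = eval w env' e.
Proof.
elim: e d env env' =>
  [v|//|e1 IH1 e2 IH2|e1 IH1 e2 IH2|e1 IH1|e0 IH0 e1 IH1 e2 IH2|v e1 IH1|u v e1 IH1] d env env' /=.
- by move=> lt_v; apply.
- by move=> /andP[wf1 wf2] E; rewrite (IH1 d _ env') // (IH2 d _ env').
- by move=> /andP[wf1 wf2] E; rewrite (IH1 d _ env') // (IH2 d _ env').
- by move=> wf1 E; rewrite (IH1 d _ env').
- by move=> /and3P[wf0 wf1 wf2] E; rewrite (IH0 d _ env') // (IH1 d _ env') // (IH2 d _ env').
- move=> /andP[/eqP -> wf1] E; apply: eq_bigr => i _; apply: (IH1 d.+1) => // a lt_a.
  by rewrite /updR; case: eqP => // ne_a; apply: E; lia.
move=> /and3P[/eqP -> /eqP -> wf1] E; apply: eq_iteri => i a; congr minn.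
apply: (IH1 d.+2) => // b lt_b; rewrite /updR; case: eqP => // ne_b.
by case: eqP => // ne_b'; apply: E; lia.
Qed.

Lemma eval_vbound w d e env X : wf d e -> size w <= X -> 0 < X ->
  (forall i, i < d -> env i <= X) -> eval w env e <= vbound e X.
Proof.
move=> + NX X0.
elim: e d env =>
  [v|//|e1 IH1 e2 IH2|e1 IH1 e2 IH2|e1 IH1|e0 IH0 e1 IH1 e2 IH2|v e1 IH1|u v e1 IH1] d env /=.
- by move=> lt_v; apply.
- by move=> /andP[wf1 wf2] E; apply: leq_add; [apply: IH1 E | apply: IH2 E].
- by move=> _ _; apply: leq_b1.
- by move=> _ _; apply: leq_b1.
- move=> /and3P[wf0 wf1 wf2] E; case: ifP => _.
    by apply: leq_trans (leq_addr _ _); apply: IH1 E.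
  by apply: leq_trans (leq_addl _ _); apply: IH2 E.
- move=> /andP[/eqP -> wf1] E; apply: (@leq_trans (\sum_(i < size w) vbound e1 X)).
    apply: leq_sum => i _; apply: (IH1 d.+1) => // a lt_a.
    rewrite /updR; case: eqP => [_|ne_a]; first by have := ltn_ord i; lia.
    by apply: E; lia.
  by rewrite sum_nat_const card_ord leq_mul2r NX orbT.
by move=> _ _; case: (size w) NX => //= n nX; rewrite geq_min nX.
Qed.

(** * Compilation of expressions *)

Section CompileExp.
Variables (m : nat) (D : nat).

(** Variables occupy the registers below [D]; from [s] on the registers form an evaluation stack,
    and the result is left in [s]. *)
Fixpoint compile (e : exp) (s : nat) : frag unit :=
  match e with
  | EVar v => copy m s v
  | EOne => reset m s ;; inc m s
  | EAdd e1 e2 => compile e1 s ;; compile e2 s.+1 ;; addto m s s.+1 s.+2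
  | ELt e1 e2 => compile e1 s ;; compile e2 s.+1 ;; b <~ ltreg m s s.+1 ;;
                 reset m s ;; if b then inc m s else ret tt
  | EBit e1 => compile e1 s ;; b <~ getbit m 1 s ;;
               reset m s ;; if b then inc m s else ret tt
  | EIf e0 e1 e2 => compile e0 s ;; reset m s.+1 ;; b <~ ltreg m s.+1 s ;;
                    if b then compile e1 s else compile e2 s
  | ESum v e1 => reset m s ;; for_reg m v (compile e1 s.+1 ;; addto m s s.+1 s.+2)
  | ERec u v e1 => reset m u ;; inc m u ;;
                   for_reg m v (compile e1 s ;; copymin m u s) ;; copy m s u
  end.

Variables (w : seq bool) (X Y : nat).
Hypotheses (NX : size w <= X) (X0 : 0 < X).

(** The visible variables and the pending results of enclosing expressions survive; inner binders
    and the stack from [s] on may be overwritten. *)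
Definition kept d s (R R' : nat -> nat) :=
  forall i, (i < d) || ((D <= i) && (i < s)) -> R' i = R i.

Lemma setbit_run R out s (b : bool) : s < m -> 2 < Y ->
  reg_runs m w Y (reset m s ;; if b then inc m s else ret tt) R out 2 tt (updR R s b) out.
Proof.
move=> lt_s Y2; rewrite -[2]/(1 + 1); apply: reg_runs_bind; first exact: reg_runs_reset.
case: b; last by apply: (@reg_runs_leq _ _ _ _ _ _ _ 0) => //; apply: reg_runs_ret.
by have := @reg_runs_inc m w Y (updR R s 0) out s lt_s; rewrite updR_eq updRR; apply; lia.
Qed.

(** [X] bounds the variables and [Y] the tape: [sbound e X <= Y] ensures that no increment needs a
    block beyond [Y], and every loop makes at most [Y] passes. *)
Lemma compileP e d s R out : wf d e -> d <= D -> binders e <= D -> D <= s ->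
  s + temps e <= m -> (forall i, i < d -> R i <= X) -> sbound e X <= Y ->
  exists R', [/\ reg_runs m w Y (compile e s) R out (tbound e Y) tt R' out,
                 R' s = eval w R e & kept d s R R'].
Proof.
elim: e d s R out =>
  [v||e1 IH1 e2 IH2|e1 IH1 e2 IH2|e1 IH1|e0 IH0 e1 IH1 e2 IH2|v e1 IH1|u v e1 IH1] d s R out /=.
- move=> lt_v dD _ Ds sm RX XY; exists (updR R s (R v)).
  have ne : s != v by apply/eqP; lia.
  split; [by apply: reg_runs_copy => //; lia | by rewrite updR_eq |].
  by move=> i Hi; rewrite updR_ne //; apply/eqP; lia.
- move=> _ dD _ Ds sm RX XY; exists (updR R s 1); split.
  + rewrite -[2]/(1 + 1); apply: reg_runs_bind; first by apply: reg_runs_reset; lia.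
    have lt_s : s < m by lia.
    by have := @reg_runs_inc m w Y (updR R s 0) out s lt_s; rewrite updR_eq updRR; apply; lia.
  + by rewrite updR_eq.
  by move=> i Hi; rewrite updR_ne //; apply/eqP; lia.
- move=> /andP[wf1 wf2] dD bD Ds sm RX XY.
  have [|||||||R1 [run1 R1s kept1]] := IH1 d s R out => //; try lia.
  have [|||||i lt_i||R2 [run2 R2s kept2]] := IH2 d s.+1 R1 out => //; try lia.
    by rewrite kept1 ?lt_i // RX.
  have R2s0 : R2 s = eval w R e1 by rewrite kept2 ?R1s //; lia.
  have R2s1 : R2 s.+1 = eval w R e2.
    by rewrite R2s; apply: (@eval_ext _ d) => // i lt_i; rewrite kept1 ?lt_i.
  have v1 := @eval_vbound w d e1 R X wf1 NX X0 RX.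
  have v2 := @eval_vbound w d e2 R X wf2 NX X0 RX.
  exists (updR (updR R2 s (R2 s + R2 s.+1)) s.+2 (R2 s.+1)); split.
  + rewrite -addnA; apply: reg_runs_bind run1 _; apply: reg_runs_bind run2 _.
    by apply: reg_runs_addto; rewrite ?R2s0 ?R2s1; lia.
  + by rewrite updR_ne ?updR_eq ?R2s0 ?R2s1 //; lia.
  move=> i Hi; rewrite !updR_ne; try by apply/eqP; lia.
  by rewrite kept2 ?kept1 //; lia.
- move=> /andP[wf1 wf2] dD bD Ds sm RX XY.
  have [|||||||R1 [run1 R1s kept1]] := IH1 d s R out => //; try lia.
  have [|||||i lt_i||R2 [run2 R2s kept2]] := IH2 d s.+1 R1 out => //; try lia.
    by rewrite kept1 ?lt_i // RX.
  have R2s0 : R2 s = eval w R e1 by rewrite kept2 ?R1s //; lia.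
  have R2s1 : R2 s.+1 = eval w R e2.
    by rewrite R2s; apply: (@eval_ext _ d) => // i lt_i; rewrite kept1 ?lt_i.
  exists (updR R2 s (eval w R e1 < eval w R e2)); split.
  + rewrite -addnA; apply: reg_runs_bind run1 _; apply: reg_runs_bind run2 _.
    rewrite -[3]/(1 + 2); apply: reg_runs_bind; first by apply: reg_runs_lt; lia.
    by rewrite R2s0 R2s1; apply: setbit_run; lia.
  + by rewrite updR_eq.
  move=> i Hi; rewrite !updR_ne; try by apply/eqP; lia.
  by rewrite kept2 ?kept1 //; lia.
- move=> wf1 dD bD Ds sm RX XY.
  have [|||||||R1 [run1 R1s kept1]] := IH1 d s R out => //; try lia.
  exists (updR R1 s (nth false w (eval w R e1))); split.
  + apply: reg_runs_bind run1 _.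
    rewrite -[3]/(1 + 2); apply: reg_runs_bind; first by apply: reg_runs_bit; lia.
    by rewrite R1s; apply: setbit_run; lia.
  + by rewrite updR_eq.
  move=> i Hi; rewrite !updR_ne; try by apply/eqP; lia.
  by rewrite kept1 //; lia.
- move=> /and3P[wf0 wf1 wf2] dD bD Ds sm RX XY.
  have [|||||||R1 [run1 R1s kept1]] := IH0 d s R out => //; try lia.
  pose R2 := updR R1 s.+1 0.
  have R2d i : i < d -> R2 i = R i.
    by move=> lt_i; rewrite /R2 updR_ne ?kept1 ?lt_i //; apply/eqP; lia.
  have [R3 [run3 R3s kept3]] : exists R3,
      [/\ reg_runs m w Y (if 0 < eval w R e0 then compile e1 s else compile e2 s) R2 out
            (tbound e1 Y + tbound e2 Y) tt R3 out,
          R3 s = (if 0 < eval w R e0 then eval w R e1 else eval w R e2) & kept d s R2 R3].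
    case: ifP => _.
      have [|||||i lt_i||R3 [run3 R3s kept3]] := IH1 d s R2 out => //; try lia.
        by rewrite R2d // RX.
      exists R3; split=> //; first exact: reg_runs_leq (leq_addr _ _) run3.
      by rewrite R3s; apply: (@eval_ext _ d).
    have [|||||i lt_i||R3 [run3 R3s kept3]] := IH2 d s R2 out => //; try lia.
      by rewrite R2d // RX.
    exists R3; split=> //; first exact: reg_runs_leq (leq_addl _ _) run3.
    by rewrite R3s; apply: (@eval_ext _ d).
  exists R3; split=> //.
  + apply: (@reg_runs_leq _ _ _ _ _ _ _ (tbound e0 Y + (1 + (1 + (tbound e1 Y + tbound e2 Y))))); first by lia.
    apply: reg_runs_bind run1 _; apply: reg_runs_bind; first by apply: reg_runs_reset; lia.
    apply: reg_runs_bind; first by apply: reg_runs_lt; lia.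
    rewrite updR_eq updR_ne; last by apply/eqP; lia.
    by rewrite R1s.
  by move=> i Hi; rewrite kept3 // /R2 updR_ne ?kept1 //; apply/eqP; lia.
- move=> /andP[/eqP -> wf1] dD bD Ds sm RX XY.
  pose Inv x (R1 : nat -> nat) (out1 : seq bool) :=
    [/\ out1 = out, R1 s = \sum_(i < x) eval w (updR R d i) e1 & kept d s R R1].
  have := @reg_runs_for_reg m w Y d (compile e1 s.+1;; addto m s s.+1 s.+2)
     (tbound e1 Y + (3 * Y + 2)) Inv (updR R s 0) out.
  case=> [||x R1 out1 lt_x [-> R1s kept1] R1d||R' [out' [run [outE R's kept']]]].
  + lia.
  + split=> //; first by rewrite big_ord0 updR_ne ?updR_eq //; apply/eqP; lia.
    by move=> i Hi; rewrite !updR_ne //; apply/eqP; lia.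
  + have R1X i : i < d.+1 -> R1 i = updR R d x i.
      by rewrite /updR; case: eqP => [->|ne_i] // lt_i; apply: kept1; lia.
    have RXX i : i < d.+1 -> R1 i <= X.
      move=> lt_i; rewrite R1X // /updR; case: eqP => [_|ne_i]; first by lia.
      by apply: RX; lia.
    have [|||||||R2 [run2 R2s kept2]] := IH1 d.+1 s.+1 R1 out => //; try lia.
    have v2 := @eval_vbound w d.+1 e1 R1 X wf1 NX X0 RXX.
    have R2s0 : R2 s = R1 s by rewrite kept2 //; lia.
    have Eev : eval w R1 e1 = eval w (updR R d x) e1 by apply: eval_ext wf1 R1X.
    have v1 : R1 s <= X * vbound e1 X.
      rewrite R1s; apply: (@leq_trans (\sum_(i < x) vbound e1 X)).
        apply: leq_sum => i _; apply: (@eval_vbound w d.+1) => // a lt_a.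
        rewrite /updR; case: eqP => [_|ne_a]; first by have := ltn_ord i; lia.
        by apply: RX; lia.
      by rewrite sum_nat_const card_ord leq_mul2r; lia.
    exists (updR (updR R2 s (R2 s + R2 s.+1)) s.+2 (R2 s.+1)), out; split.
    * apply: reg_runs_bind run2 _.
      by apply: reg_runs_addto; rewrite ?R2s0 ?R2s; lia.
    * rewrite !updR_ne; try by apply/eqP; lia.
      by rewrite kept2 ?R1d //; lia.
    split=> //.
      rewrite big_ord_recr /= -R1s -Eev.
      rewrite updR_ne; last by apply/eqP; lia.
      rewrite updR_ne; last by apply/eqP; lia.
      by rewrite updR_eq R2s0 R2s.
    move=> i Hi; rewrite !updR_ne; try by apply/eqP; lia.
    by rewrite kept2 ?kept1 //; lia.
  + lia.
  exists R'; rewrite outE in run; split=> //.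
  rewrite (_ : 3 + _ = 1 + (2 + Y * (tbound e1 Y + (3 * Y + 2) + 2))) //.
  by apply: reg_runs_bind run; apply: reg_runs_reset; lia.
move=> /and3P[/eqP -> /eqP -> wf1] dD bD Ds sm RX XY.
pose f i a := minn (size w) (eval w (updR (updR R d a) d.+1 i) e1); rewrite -/f.
pose Inv x (R1 : nat -> nat) (out1 : seq bool) :=
  [/\ out1 = out, R1 d = iteri x f 1 & kept d s R R1].
have := @reg_runs_for_reg m w Y d.+1 (compile e1 s;; copymin m d s)
   (tbound e1 Y + (3 * Y + 3)) Inv (updR R d 1) out.
case=> [||x R1 out1 lt_x [-> R1d kept1] R1v||R' [out' [run [outE R'd kept']]]].
- lia.
- split=> //; first by rewrite updR_ne ?updR_eq //; apply/eqP; lia.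
  by move=> i Hi; rewrite !updR_ne //; apply/eqP; lia.
- have R1X i : i < d.+2 -> R1 i = updR (updR R d (iteri x f 1)) d.+1 x i.
    rewrite /updR; case: eqP => [->|ne_i] // lt_i; case: eqP => [->|ne_i'] //.
    by apply: kept1; lia.
  have RXX i : i < d.+2 -> R1 i <= X.
    move=> lt_i; rewrite R1X // /updR; case: eqP => [_|ne_i]; first by lia.
    case: eqP => [_|ne_i']; last by apply: RX; lia.
    by case: (x) => //= x'; rewrite /f; apply: leq_trans (geq_minl _ _) NX.
  have [|||||||R2 [run2 R2s kept2]] := IH1 d.+2 s R1 out => //; try lia.
  exists (updR R2 d (minn (size w) (R2 s))), out; split.
  + by apply: reg_runs_bind run2 _; apply: reg_runs_copymin; lia.
  + rewrite !updR_ne; try by apply/eqP; lia.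
    by rewrite kept2 ?R1v //; lia.
  split=> //.
    rewrite /= /f -(@eval_ext w d.+2 e1 R1) // -R2s.
    by rewrite updR_ne ?updR_eq //; apply/eqP; lia.
  move=> i Hi; rewrite !updR_ne; try by apply/eqP; lia.
  by rewrite kept2 ?kept1 //; lia.
- lia.
rewrite outE in run; exists (updR R' s (R' d)); split.
- rewrite (_ : 4 + _ + _ = 1 + (1 + ((2 + Y * (tbound e1 Y + (3 * Y + 3) + 2)) + (2 * Y + 2)))) //.
  apply: reg_runs_bind; first by apply: reg_runs_reset; lia.
  apply: reg_runs_bind.
    have lt_d : d < m by lia.
    by have := @reg_runs_inc m w Y (updR R d 0) out d lt_d; rewrite updR_eq updRR; apply; lia.
  by apply: reg_runs_bind run _; apply: reg_runs_copy; lia.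
- by rewrite updR_eq.
by move=> i Hi; rewrite updR_ne ?kept' //; apply/eqP; lia.
Qed.

End CompileExp.

(** * Programs with output and their polynomial running time *)

Inductive cmd :=
  | CEmit of exp
  | CIf of exp & cmd
  | CFor of nat & cmd
  | CSeq of cmd & cmd.

Fixpoint ceval (w : seq bool) (env : nat -> nat) (c : cmd) : seq bool :=
  match c with
  | CEmit e => [:: 0 < eval w env e]
  | CIf e c1 => if 0 < eval w env e then ceval w env c1 else [::]
  | CFor v c1 => flatten [seq ceval w (updR env v i) c1 | i <- iota 0 (size w)]
  | CSeq c1 c2 => ceval w env c1 ++ ceval w env c2
  end.

Fixpoint cwf (d : nat) (c : cmd) : bool :=
  match c with
  | CEmit e => wf d e
  | CIf e c1 => wf d e && cwf d c1
  | CFor v c1 => (v == d) && cwf d.+1 c1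
  | CSeq c1 c2 => cwf d c1 && cwf d c2
  end.

Fixpoint cbinders (c : cmd) : nat :=
  match c with
  | CEmit e => binders e
  | CIf e c1 => binders e + cbinders c1
  | CFor v c1 => v.+1 + cbinders c1
  | CSeq c1 c2 => cbinders c1 + cbinders c2
  end.

Fixpoint ctemps (c : cmd) : nat :=
  match c with
  | CEmit e => temps e + 2
  | CIf e c1 => temps e + ctemps c1 + 2
  | CFor v c1 => ctemps c1
  | CSeq c1 c2 => ctemps c1 + ctemps c2
  end.

Fixpoint obound (c : cmd) (X : nat) : nat :=
  match c with
  | CEmit e => 1
  | CIf e c1 => obound c1 X
  | CFor v c1 => X * obound c1 X
  | CSeq c1 c2 => obound c1 X + obound c2 X
  end.

Fixpoint csbound (c : cmd) (X : nat) : nat :=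
  match c with
  | CEmit e => sbound e X
  | CIf e c1 => sbound e X + csbound c1 X
  | CFor v c1 => csbound c1 X + X.+1
  | CSeq c1 c2 => csbound c1 X + csbound c2 X
  end.

Fixpoint ctbound (c : cmd) (Y : nat) : nat :=
  match c with
  | CEmit e => tbound e Y + 3
  | CIf e c1 => tbound e Y + ctbound c1 Y + 2
  | CFor v c1 => 2 + Y * (ctbound c1 Y + 2)
  | CSeq c1 c2 => ctbound c1 Y + ctbound c2 Y
  end.

Lemma ceval_ext w d c env env' : cwf d c -> (forall i, i < d -> env i = env' i) ->
  ceval w env c = ceval w env' c.
Proof.
elim: c d env env' => [e|e c IHc|v c IHc|c1 IH1 c2 IH2] d env env' /=.
- by move=> wfe E; rewrite (eval_ext _ wfe E).
- by move=> /andP[wfe wfc] E; rewrite (eval_ext _ wfe E) (IHc d _ env').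
- move=> /andP[/eqP -> wfc] E; congr flatten; apply: eq_map => i.
  apply: (IHc d.+1) => // a lt_a.
  by rewrite /updR; case: eqP => // ne_a; apply: E; lia.
by move=> /andP[wf1 wf2] E; rewrite (IH1 d _ env') // (IH2 d _ env').
Qed.

Lemma size_ceval w c env X : size w <= X -> size (ceval w env c) <= obound c X.
Proof.
move=> NX; elim: c env => [e|e c IHc|v c IHc|c1 IH1 c2 IH2] env //=.
- by case: ifP.
- rewrite size_flatten /shape sumnE !big_map.
  apply: (@leq_trans (\sum_(i <- iota 0 (size w)) obound c X)); first exact: leq_sum.
  by rewrite big_const_seq count_predT size_iota iter_addn_0 mulnC leq_mul2r NX orbT.
by rewrite size_cat leq_add.
Qed.

Section CompileCmd.
Variables (m : nat) (D : nat).

Definition test_nonzero s : frag bool := reset m s.+1 ;; ltreg m s.+1 s.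

Fixpoint ccompile (c : cmd) (s : nat) : frag unit :=
  match c with
  | CEmit e => compile m e s ;; b <~ test_nonzero s ;; emit b
  | CIf e c1 => compile m e s ;; b <~ test_nonzero s ;; if b then ccompile c1 s else ret tt
  | CFor v c1 => for_reg m v (ccompile c1 s)
  | CSeq c1 c2 => ccompile c1 s ;; ccompile c2 s
  end.

Variables (w : seq bool) (X Y : nat).
Hypotheses (NX : size w <= X) (X0 : 0 < X).

Lemma test_nonzero_run s R out : s.+1 < m ->
  reg_runs m w Y (test_nonzero s) R out 2 (0 < R s) (updR R s.+1 0) out.
Proof.
move=> lt_s; rewrite -[2]/(1 + 1); apply: reg_runs_bind; first by apply: reg_runs_reset; lia.
have := @reg_runs_lt m w Y (updR R s.+1 0) out s.+1 s lt_s.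
by rewrite updR_eq updR_ne; [apply; lia | apply/eqP; lia].
Qed.

Lemma ccompileP c d s R out : cwf d c -> d <= D -> cbinders c <= D -> D <= s ->
  s + ctemps c <= m -> (forall i, i < d -> R i <= X) -> csbound c X <= Y ->
  size out + obound c X <= Y ->
  exists R', reg_runs m w Y (ccompile c s) R out (ctbound c Y) tt R' (out ++ ceval w R c)
             /\ kept D d s R R'.
Proof.
elim: c d s R out => [e|e c IHc|v c IHc|c1 IH1 c2 IH2] d s R out /=.
- move=> wfe dD bD Ds sm RX XY oY.
  have [|||||||R1 [run1 R1s kept1]] := @compileP m D w X Y NX X0 e d s R out => //; try lia.
  exists (updR R1 s.+1 0); split.
    apply: reg_runs_bind run1 _; rewrite -[3]/(2 + 1).
    apply: reg_runs_bind; first by apply: test_nonzero_run; lia.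
    by rewrite R1s cats1; apply: reg_runs_emit; lia.
  by move=> i Hi; rewrite updR_ne ?kept1 //; apply/eqP; lia.
- move=> /andP[wfe wfc] dD bD Ds sm RX XY oY.
  have [|||||||R1 [run1 R1s kept1]] := @compileP m D w X Y NX X0 e d s R out => //; try lia.
  pose R2 := updR R1 s.+1 0.
  have kept2 : kept D d s R R2.
    by move=> i Hi; rewrite /R2 updR_ne ?kept1 //; apply/eqP; lia.
  rewrite -addnA [_ + 2]addnC.
  have run2 : reg_runs m w Y (test_nonzero s) R1 out 2 (0 < eval w R e) R2 out.
    by rewrite -R1s; apply: test_nonzero_run; lia.
  case: ifP => Ee; last first.
    exists R2; split=> //; rewrite cats0; apply: reg_runs_bind run1 _; apply: reg_runs_bind run2 _.
    by rewrite Ee; apply: (@reg_runs_leq _ _ _ _ _ _ _ 0) => //; apply: reg_runs_ret.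
  have [|||||i lt_i|||R3 [run3 kept3]] := IHc d s R2 out => //; try lia.
    by rewrite kept2 ?lt_i // RX.
  exists R3; split; last by move=> i Hi; rewrite kept3 ?kept2.
  apply: reg_runs_bind run1 _; apply: reg_runs_bind run2 _; rewrite Ee.
  rewrite -(@ceval_ext w d c R2 R) // => i lt_i.
  by rewrite kept2 ?lt_i.
- move=> /andP[/eqP -> wfc] dD bD Ds sm RX XY oY.
  pose o x := flatten [seq ceval w (updR R d i) c | i <- iota 0 x].
  pose Inv x (R1 : nat -> nat) (out1 : seq bool) := out1 = out ++ o x /\ kept D d s R R1.
  have := @reg_runs_for_reg m w Y d (ccompile c s) (ctbound c Y) Inv R out.
  case=> [||x R1 out1 lt_x [-> kept1] R1d||R' [out' [run [outE kept']]]].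
  + lia.
  + split; first by rewrite /o /= cats0.
    by move=> i Hi; rewrite !updR_ne //; apply/eqP; lia.
  + have R1X i : i < d.+1 -> R1 i = updR R d x i.
      by rewrite /updR; case: eqP => [->|ne_i] // lt_i; apply: kept1; lia.
    have RXX i : i < d.+1 -> R1 i <= X.
      move=> lt_i; rewrite R1X // /updR; case: eqP => [_|ne_i]; first by lia.
      by apply: RX; lia.
    have oX : size (o x) <= x * obound c X.
      rewrite /o size_flatten /shape sumnE !big_map.
      apply: (@leq_trans (\sum_(i <- iota 0 x) obound c X)).
        by apply: leq_sum => i _; apply: size_ceval.
      by rewrite big_const_seq count_predT size_iota iter_addn_0 mulnC.
    have oXY : x.+1 * obound c X <= X * obound c X by rewrite leq_mul2r; lia.
    have [||||||||R2 [run2 kept2]] := IHc d.+1 s R1 (out ++ o x) => //; try lia.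
      by rewrite size_cat; rewrite mulSn in oXY; lia.
    exists R2, (out ++ o x ++ ceval w R1 c); split.
    * by rewrite catA.
    * by rewrite kept2 ?R1d //; lia.
    split; last first.
      by move=> i Hi; rewrite updR_ne ?kept2 ?kept1 //; try (apply/eqP); lia.
    rewrite /o -[in RHS]addn1 iotaD map_cat flatten_cat /= cats0 add0n.
    by rewrite (ceval_ext _ wfc R1X).
  + lia.
  by exists R'; rewrite outE in run.
move=> /andP[wf1 wf2] dD bD Ds sm RX XY oY.
have o1 := @size_ceval w c1 R X NX.
have [||||||||R1 [run1 kept1]] := IH1 d s R out => //; try lia.
have [|||||i lt_i|||R2 [run2 kept2]] := IH2 d s R1 (out ++ ceval w R c1) => //; try lia.
- by rewrite kept1 ?lt_i // RX.
- by rewrite size_cat; lia.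
exists R2; split; last by move=> i Hi; rewrite kept2 ?kept1.
apply: reg_runs_bind run1 _; rewrite catA -(@ceval_ext w d c2 R1 R) // => i lt_i.
by rewrite kept1 ?lt_i.
Qed.

End CompileCmd.

Ltac poly_solve := repeat first
  [ assumption | exact: poly_bounded_id | exact: poly_bounded_const
  | apply: poly_bounded_add | apply: poly_bounded_mul ].

Lemma poly_boundedS f : poly_bounded f -> poly_bounded (fun x => (f x).+1).
Proof.
move=> fP; apply: (@poly_bounded_leq _ (fun x => f x + 1)); first by move=> x; lia.
by poly_solve.
Qed.

Lemma vbound_poly e : poly_bounded (vbound e).
Proof. by elim: e => * /=; poly_solve. Qed.

Lemma sbound_poly e : poly_bounded (sbound e).
Proof.
elim: e => * /=; poly_solve; try exact: vbound_poly; by repeat apply: poly_boundedS; poly_solve.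
Qed.

Lemma tbound_poly e : poly_bounded (tbound e).
Proof. by elim: e => * /=; poly_solve. Qed.

Lemma obound_poly c : poly_bounded (obound c).
Proof. by elim: c => * /=; poly_solve. Qed.

Lemma csbound_poly c : poly_bounded (csbound c).
Proof.
elim: c => * /=; poly_solve; try exact: sbound_poly; by repeat apply: poly_boundedS; poly_solve.
Qed.

Lemma ctbound_poly c : poly_bounded (ctbound c).
Proof. by elim: c => * /=; poly_solve; exact: tbound_poly. Qed.

Lemma cmd_poly_time c : cwf 0 c -> poly_time_computable (fun w => ceval w (fun=> 0) c).
Proof.
move=> wfc; pose D := cbinders c; pose m := D + ctemps c.
(* Values are measured with [X = N.+1], which is positive also for the empty word; the summand
   [N.+2] makes room for the block that [load] adds. *)
pose Yb N := csbound c N.+1 + obound c N.+1 + N.+2.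
(* The last two moves lead from cell 1 over the blank cell 0 to the first output cell, where
   [output] starts reading. *)
pose M := load m ;; ccompile m c D ;; mvn true 2.
pose tm N := N.+3 * cost m N + (ctbound c (Yb N) * cost m (Yb N) + 2).
have Yb_poly : poly_bounded Yb.
  apply: poly_bounded_add; last by do 2 apply: poly_boundedS; apply: poly_bounded_id.
  apply: poly_bounded_add.
    by apply: poly_bounded_comp (csbound_poly c) (poly_boundedS poly_bounded_id).
  by apply: poly_bounded_comp (obound_poly c) (poly_boundedS poly_bounded_id).
have cost_poly : poly_bounded (cost m).
  rewrite /cost; poly_solve; do 2 apply: poly_boundedS; exact: poly_bounded_id.
have [C tmC] : exists C, forall x, tm x <= C * x ^ C + C.
  apply: poly_boundedP; rewrite /tm; apply: poly_bounded_add.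
    apply: poly_bounded_mul cost_poly; do 3 apply: poly_boundedS; exact: poly_bounded_id.
  apply: poly_bounded_add (poly_bounded_const _).
  apply: poly_bounded_mul; first exact: poly_bounded_comp (ctbound_poly c) Yb_poly.
  exact: poly_bounded_comp cost_poly Yb_poly.
exists (frag_TM M), C => w; set out := ceval _ _ _; set N := size w.
pose R := fun _ : nat => N.
have [||||||||R' [[run] _]] :=
  @ccompileP m D w N.+1 (Yb N) (leqnSn _) isT c 0 D R [::] => //.
- by rewrite /Yb; lia.
- by rewrite /Yb /=; lia.
have [|||L' [_ _ _ {}run]] := run N.+1 => //; first by rewrite /Yb; lia.
(* After loading, the registers hold [N] and not 0; a program without free variables cannot tell. *)
have outE : ceval w R c = out by apply: ceval_ext wfc _.
suff : runs_within (frag_TM M) w (tm N) out.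
  by move=> [n [le_n H]]; exists n; split=> //; apply: leq_trans (tmC N).
apply: (@runs_TM _ _ _ (cont m w R' L' out) (-1)%Z); last first.
  by move=> i; rewrite (_ : shiftn true i (-1) = (- Z.of_nat i.+1)%Z) ?cont_out // /shiftn; lia.
apply: runs_bind; first exact: runs_load.
apply: runs_bind; first by rewrite outE in run; exact: run.
exact: runs_mvn.
Qed.

(** * Sparsification *)

Lemma card_bigcup_leq (T I : finType) (J : {set I}) (A : I -> {set T}) b :
  (forall i, i \in J -> #|A i| <= b) -> #|\bigcup_(i in J) A i| <= #|J| * b.
Proof.
move=> Ab; rewrite -sum_nat_const.
apply: (@leq_trans (\sum_(i in J) #|A i|)); last exact: leq_sum.
apply: (big_ind2 (fun (B : {set T}) s => #|B| <= s)) => //; first by rewrite cards0.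
move=> B1 s1 B2 s2 le1 le2; rewrite cardsU.
by apply: leq_trans (leq_subr _ _) _; apply: leq_add.
Qed.

Lemma card_cover_leq (T I : finType) (S : {set T}) (J : {set I}) (A : I -> {set T}) b :
  (forall y, y \in S -> exists2 i, i \in J & y \in A i) ->
  (forall i, i \in J -> #|A i| <= b) -> #|S| <= #|J| * b.
Proof.
move=> cov Ab; apply: leq_trans (card_bigcup_leq Ab).
apply/subset_leq_card/subsetP => y /cov [i iJ yA].
by apply/bigcupP; exists i.
Qed.

Section Sparsify.
Variables (t n : nat) (adj : rel 'I_n) (kap : nat).
Hypothesis kap_gt0 : 0 < kap.
Notation T := {ffun 'I_t -> 'I_n}.
Variable rk : T -> nat.
Hypothesis rk_inj : injective rk.

Definition cliq (x : T) := [forall a, forall b, (a != b) ==> adj (x a) (x b)].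
Definition agree (P : {set 'I_t}) (x y : T) := [forall (a | a \in P), y a == x a].

(* The exponent at [s = 0] is the one at [s = 1]: a tuple is hit by a pair of its
   entries, so the number of tuples without prescribed entries is controlled by
   [thr 2] directly. *)
Definition thr s := ((4 * t * t + 1) * kap) ^ (t - maxn s 1).

(** The test counts smaller tuples of the previous round, including those that the same round
    discards. Hence a round needs no recursion along [rk] and is expressible by bounded sums. *)
Fixpoint fam (j : nat) (x : T) : bool :=
  match j with
  | 0 => cliq x
  | j'.+1 => fam j' x && [forall (P : {set 'I_t} | #|P| == t - j'.+1),
      #|[set y | [&& fam j' y, agree P x y & rk y < rk x]]| < thr (t - j'.+1)]
  end.

Lemma famS j x : fam j.+1 x = fam j x && [forall (P : {set 'I_t} | #|P| == t - j.+1),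
  #|[set y | [&& fam j y, agree P x y & rk y < rk x]]| < thr (t - j.+1)].
Proof. by []. Qed.

Lemma thr_gt0 s : 0 < thr s.
Proof. by rewrite expn_gt0 muln_gt0 kap_gt0; lia. Qed.

Lemma thrS s : 0 < s -> s < t -> thr s = (4 * t * t + 1) * kap * thr s.+1.
Proof.
move=> s0 st; rewrite /thr -expnS; congr (_ ^ _).
by rewrite !maxnE; lia.
Qed.

Lemma thr0 : 1 < t -> thr 0 = (4 * t * t + 1) * kap * thr 2.
Proof. by move=> t1; rewrite /thr -expnS; congr (_ ^ _); rewrite !maxnE; lia. Qed.

Lemma agreeP (P : {set 'I_t}) (x y : T) : reflect {in P, y =1 x} (agree P x y).
Proof.
by apply: (iffP forall_inP) => H a aP; apply/eqP; [exact: H | rewrite H].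
Qed.

Lemma fam_leq i j x : i <= j -> fam j x -> fam i x.
Proof.
move=> le_ij; rewrite -(subnK le_ij); elim: (j - i) => // l IHl.
by rewrite addSn famS => /andP[/IHl].
Qed.

(** By induction on [j], only [#|Q| = t - j] is new in round [j]. There take the largest survivor
    [y] agreeing with [x] on [Q]: all the others are smaller and agree with [y] on [Q], and [y]
    passed its test, so they number less than [thr]. *)
Lemma fam_deg j (Q : {set 'I_t}) (x : T) : j <= t -> t - j <= #|Q| ->
  #|[set y | fam j y & agree Q x y]| <= thr #|Q|.
Proof.
elim: j x => [|j IHj] x jt Qt.
  apply: (@leq_trans #|[set x]|); last by rewrite cards1 thr_gt0.
  have QT : Q = setT.
    apply/eqP; rewrite eqEcard subsetT cardsT card_ord.
    by rewrite subn0 in Qt.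
  apply/subset_leq_card/subsetP => y; rewrite !inE QT => /andP[_ /agreeP yx].
  by apply/eqP/ffunP => a; apply: yx; rewrite inE.
have [Qt'|ltQ] := leqP (t - j) #|Q|.
  apply: leq_trans (IHj x (ltnW jt) Qt'); apply/subset_leq_card/subsetP => y.
  by rewrite !inE famS => /andP[/andP[-> _] ->].
have Qj : #|Q| == t - j.+1 by apply/eqP; lia.
set S := [set _ | _ & _].
have [->|[y0 y0S]] := set_0Vmem S; first by rewrite cards0.
case: (@arg_maxnP _ y0 (mem S) rk y0S) => y /= yS ymax.
rewrite (cardsD1 y) yS add1n.
move: yS; rewrite /S in_set famS => /andP[/andP[famy /forall_inP /(_ Q Qj)]].
rewrite -(eqP Qj) => lty /agreeP yx; apply: leq_ltn_trans lty.
apply/subset_leq_card/subsetP => z; rewrite !inE => /andP[ne_zy] zS.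
move: (zS); rewrite famS => /andP[/andP[-> _] /agreeP zx] /=; apply/andP; split.
  by apply/agreeP => a aQ; rewrite zx // yx.
rewrite ltn_neqAle (inj_eq rk_inj) ne_zy /=; apply: ymax.
by rewrite /S inE.
Qed.

(** * Hitting the survivors implies hitting all cliques *)

Section Hit.
Variable F : {set {set 'I_n}}.
Hypotheses (F2 : forall e, e \in F -> #|e| <= 2) (Fkap : #|F| < kap).

Definition hit (x : T) := [exists a, exists b, (a != b) && ([set x a; x b] \in F)].

Lemma hitP (x : T) : reflect (exists a b, a != b /\ [set x a; x b] \in F) (hit x).
Proof.
apply: (iffP existsP) => [[a /existsP[b /andP[? ?]]]|[a [b [? ?]]]].
  by exists a, b.
by exists a; apply/existsP; exists b; apply/andP.
Qed.

Lemma card_coverF : #|cover F| <= 2 * #|F|.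
Proof.
apply: leq_trans (leq_card_cover F) _.
by rewrite mulnC -sum_nat_const; apply: leq_sum.
Qed.

(** An edge with at most two ends gives at most four ordered pairs, repetitions included; this is
    the 4 in [thr]. *)
Lemma card_pairsF : #|[set p : 'I_n * 'I_n | [set p.1; p.2] \in F]| <= #|F| * 4.
Proof.
apply: (@card_cover_leq _ _ _ _ (fun e : {set 'I_n} => setX e e)) => [p|e eF].
  by rewrite inE => pF; exists [set p.1; p.2] => //; rewrite !inE !eqxx orbT.
by rewrite cardsX; have := leq_mul (F2 eF) (F2 eF).
Qed.

(** The core count: the members of [S] are classified by how [F] hits them, and each class
    prescribes more coordinates than [P], so [fam_deg] bounds it by a threshold of a higher
    level. *)
Lemma few_hit j (P : {set 'I_t}) (x : T) (S := [set y | [&& fam j y, agree P x y & rk y < rk x]]) :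
  j < t -> #|P| = t - j.+1 -> ~~ hit x -> {in S, forall y, hit y} ->
  #|S| < thr (t - j.+1).
Proof.
move=> jt Pj Nhx hS; have [s0|s_gt0] := posnP (t - j.+1).
  (* With at most one coordinate no tuple can be hit, so [S] is empty. *)
  have [t1|t1] := leqP t 1.
    rewrite (_ : S = set0) ?cards0 ?thr_gt0 //; apply/setP => y; rewrite in_set0.
    apply/negP => /hS /hitP[a [b [/eqP []]]]; apply/val_inj => /=.
    by have := ltn_ord a; have := ltn_ord b; lia.
  rewrite s0 thr0 //.
  apply: (@leq_ltn_trans (t * t * (#|F| * 4) * thr 2)); last first.
    by rewrite ltn_mul2r thr_gt0; nia.
  (* A class prescribes two coordinates and, as their values, the ends of an edge of [F]. There are
     at most [t * t * (#|F| * 4)] classes of at most [thr 2] tuples; this is where [4 * t * t]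
     originates. *)
  pose J := setX [set p : 'I_t * 'I_t | p.1 != p.2]
                 [set p : 'I_n * 'I_n | [set p.1; p.2] \in F].
  pose A (i : ('I_t * 'I_t) * ('I_n * 'I_n)) :=
    [set y in S | (y i.1.1 == i.2.1) && (y i.1.2 == i.2.2)].
  apply: (@leq_trans (#|J| * thr 2)).
    apply: (@card_cover_leq _ _ _ _ A) => [y yS|[[a b] [u v]]].
      have /hitP[a [b [ne_ab abF]]] := hS y yS.
      exists ((a, b), (y a, y b)); first by rewrite !inE ne_ab.
      by rewrite in_set yS /= !eqxx.
    rewrite !inE /= => /andP[ne_ab _].
    have [->|[y0]] := set_0Vmem (A ((a, b), (u, v))); first by rewrite cards0.
    rewrite in_set => /andP[_ /= /andP[/eqP y0a /eqP y0b]].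
    have c2 : #|[set a; b]| = 2 by rewrite cards2 ne_ab.
    rewrite -[in thr 2]c2; apply: leq_trans (@fam_deg j [set a; b] y0 (ltnW jt) _);
      last by rewrite c2; lia.
    apply/subset_leq_card/subsetP => y; rewrite {1}/A in_set => /andP[/= + /andP[/eqP ya /eqP yb]].
    rewrite inE => /and3P[famy _ _]; rewrite inE famy; apply/agreeP => c.
    by rewrite !inE => /orP[] /eqP ->; rewrite ?y0a ?y0b.
  rewrite leq_mul2r; apply/orP; right; rewrite cardsX leq_mul //; last exact: card_pairsF.
  by apply: leq_trans (max_card _) _; rewrite card_prod card_ord.
rewrite thrS //; last by lia.
apply: (@leq_ltn_trans (t * (2 * #|F|) * thr (t - j.+1).+1)); last first.
  by rewrite ltn_mul2r thr_gt0; nia.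
(* Here a class prescribes one coordinate outside [P] and, as its value, an end of an edge of
   [F]. *)
pose J := setX [set c : 'I_t | c \notin P] (cover F).
pose A (i : 'I_t * 'I_n) := [set y in S | y i.1 == i.2].
apply: (@leq_trans (#|J| * thr (t - j.+1).+1)).
  apply: (@card_cover_leq _ _ _ _ A) => [y yS|[c v]].
    have /hitP[a [b [ne_ab abF]]] := hS y yS.
    (* Were both coordinates in [P], where [x] and [y] coincide, the same edge would hit [x]. *)
    have : (a \notin P) || (b \notin P).
      rewrite -negb_and; apply: contra Nhx => /andP[aP bP]; apply/hitP.
      exists a, b; split=> //; move: yS; rewrite inE => /and3P[_ /agreeP yx _].
      by rewrite -!yx.
    case/orP=> cP.
      exists (a, y a); last by rewrite in_set yS /= eqxx.
      by rewrite !inE cP; apply/bigcupP; exists [set y a; y b] => //; rewrite !inE eqxx.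
    exists (b, y b); last by rewrite in_set yS /= eqxx.
    by rewrite !inE cP; apply/bigcupP; exists [set y a; y b] => //; rewrite !inE eqxx orbT.
  rewrite !inE /= => /andP[cP _].
  have [->|[y0]] := set_0Vmem (A (c, v)); first by rewrite cards0.
  rewrite in_set => /andP[/= y0S /eqP y0c].
  have cc : #|c |: P| = (t - j.+1).+1 by rewrite cardsU1 cP Pj.
  rewrite -cc; apply: leq_trans (@fam_deg j (c |: P) y0 (ltnW jt) _); last by rewrite cc; lia.
  apply/subset_leq_card/subsetP => y; rewrite {1}/A in_set => /andP[/= + /eqP yc].
  rewrite inE => /and3P[famy /agreeP yx _]; rewrite inE famy; apply/agreeP => a.
  move: y0S; rewrite inE => /and3P[_ /agreeP y0x _].
  by rewrite !inE => /orP[/eqP ->|aP]; rewrite ?y0c ?yc // yx // y0x.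
rewrite leq_mul2r; apply/orP; right; rewrite cardsX leq_mul //; last exact: card_coverF.
by apply: leq_trans (max_card _) _; rewrite card_ord.
Qed.

(** If [x] were not hit while all smaller members are, it would pass every test of the round by
    [few_hit], hence survive and be hit after all. *)
Lemma fam_hit j : j < t -> (forall x, fam j.+1 x -> hit x) -> forall x, fam j x -> hit x.
Proof.
move=> jt hitS x; have [r] := ubnP (rk x); elim: r x => // r IHr x lt_xr famx.
apply: contraT => Nhx; rewrite -(negbTE Nhx); apply: hitS; rewrite famS famx.
apply/forall_inP => P /eqP Pj; apply: few_hit => // y; rewrite inE => /and3P[famy _ lt_yx].
by apply: IHr => //; apply: leq_trans lt_yx _.
Qed.

Lemma fam_hit_all : (forall x, fam t x -> hit x) -> forall x, cliq x -> hit x.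
Proof.
suff H j : j <= t -> (forall x, fam j x -> hit x) -> forall x, cliq x -> hit x by exact: H.
elim: j => // j IHj jt hitS; apply: IHj (ltnW jt) _; exact: fam_hit hitS.
Qed.

End Hit.

(** The instance of [fam_deg] with no prescribed coordinate. *)
Lemma card_fam : #|[set x | fam t x]| <= thr 0.
Proof.
have [->|[x0 _]] := set_0Vmem [set x | fam t x]; first by rewrite cards0.
rewrite -(@cards0 'I_t); apply: leq_trans (@fam_deg t set0 x0 (leqnn t) _).
  by apply/subset_leq_card/subsetP => y; rewrite !inE => ->; apply/agreeP => a; rewrite inE.
by rewrite subnn.
Qed.

(** * The kernel graph and its size *)

Definition used (i : 'I_n) := [exists x, fam t x && [exists a, x a == i]].
Definition kadj (i j : 'I_n) := (i != j) &&
  [exists x, [&& fam t x, [exists a, x a == i] & [exists b, x b == j]]].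

Lemma usedP i : reflect (exists2 x, fam t x & exists a, x a = i) (used i).
Proof.
apply: (iffP existsP) => [[x /andP[famx /existsP[a /eqP xa]]]|[x famx [a xa]]].
  by exists x => //; exists a.
by exists x; rewrite famx; apply/existsP; exists a; apply/eqP.
Qed.

Lemma kadjP i j :
  reflect (i <> j /\ exists2 x, fam t x & exists a b, x a = i /\ x b = j) (kadj i j).
Proof.
apply: (iffP andP) => [[/eqP ne /existsP[x /and3P[famx /existsP[a /eqP xa] /existsP[b /eqP xb]]]]|].
  by split=> //; exists x => //; exists a, b.
case=> ne [x famx [a [b [xa xb]]]]; split; first exact/eqP.
apply/existsP; exists x; rewrite famx /=; apply/andP.
by split; apply/existsP; [exists a | exists b]; apply/eqP.
Qed.

(** The surviving vertices keep their order in the given graph, so that a loop over increasing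
    positions can print the new adjacency matrix. *)
Definition kverts := [seq i <- enum 'I_n | used i].
Definition kvert (a : 'I_(size kverts)) : 'I_n := tnth (in_tuple kverts) a.
Definition kgadj : rel 'I_(size kverts) := fun a b => kadj (kvert a) (kvert b).

Lemma kgadj_sym : symmetric kgadj.
Proof.
by move=> a b; apply/kadjP/kadjP => -[ne [x famx [c [d [xc xd]]]]];
  (split; first by move/esym); exists x => //; exists d, c.
Qed.

Lemma kgadj_irr : irreflexive kgadj.
Proof. by move=> a; rewrite /kgadj /kadj eqxx. Qed.

Definition kgraph := SGraph kgadj_sym kgadj_irr.

Lemma kvert_inj : injective kvert.
Proof.
move=> a b; rewrite /kvert => e; apply: val_inj; apply/eqP.
have x0 : 'I_n := kvert a.
move: e; rewrite !(tnth_nth x0) /= => e.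
have ku : uniq kverts by rewrite filter_uniq ?enum_uniq.
by rewrite -(nth_uniq x0 (ltn_ord a) (ltn_ord b) ku) e.
Qed.

Lemma kvert_onto i : used i -> exists a, kvert a = i.
Proof.
move=> ui; have ik : i \in in_tuple kverts by rewrite mem_filter ui mem_enum.
by have /tnthP[a ->] := ik; exists a.
Qed.

Lemma size_kverts : size kverts <= thr 0 * t.
Proof.
have -> : size kverts = #|[set i | used i]|.
  by rewrite cardsE cardE; congr size; rewrite /kverts enumT.
apply: leq_trans (_ : #|[set x | fam t x]| * t <= _); last by rewrite leq_mul2r card_fam orbT.
apply: (@card_cover_leq _ _ _ _ (fun x : T => [set x a | a : 'I_t])) => [i|x _].
  rewrite inE => /usedP[x famx [a <-]]; exists x; first by rewrite inE.
  by apply/imsetP; exists a.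
by apply: leq_trans (leq_imset_card _ _) _; rewrite card_ord.
Qed.

Lemma imset2 (T1 T2 : finType) (f : T1 -> T2) a b : f @: [set a; b] = [set f a; f b].
Proof. by rewrite imsetU !imset_set1. Qed.

Lemma card_kedges : #|edges kgraph| <= thr 0 * (t * t).
Proof.
pose J := setX [set x | fam t x] [set: 'I_t * 'I_t].
apply: (@leq_trans (#|J| * 1)); last first.
  rewrite muln1 cardsX cardsT card_prod card_ord leq_mul2r card_fam.
  by rewrite orbT.
(* An edge is named by a surviving tuple and two of its coordinates; as [kvert] is injective, a name
   fits at most one edge. *)
pose A (p : T * ('I_t * 'I_t)) := [set e : {set 'I_(size kverts)} |
    kvert @: e == [set p.1 p.2.1; p.1 p.2.2]].
apply: (@card_cover_leq _ _ _ _ A) => [e /imsetP[[a b]]|p _].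
  rewrite inE => /kadjP[ne [x famx [c [d [xc xd]]]]] ->.
  by exists (x, (c, d)); rewrite ?inE ?famx //= imset2 xc xd.
apply/card_le1_eqP => e1 e2; rewrite !inE => /eqP <- /eqP.
by move/(imset_inj kvert_inj).
Qed.

End Sparsify.

(** For [k > 0] one has [kap <= 2 * k]; for [k = 0] only [kap <= 1], which the additive constant
    covers. *)
Lemma thr_leq t kap k s : kap <= k.+1 ->
  thr t kap s <= ((4 * t * t + 1) * 2) ^ (t - maxn s 1) * k ^ (t - maxn s 1)
                 + (4 * t * t + 1) ^ (t - maxn s 1).
Proof.
move=> le_kap; rewrite /thr; set e := t - _; set c := 4 * t * t + 1.
have leX a b : a <= b -> a ^ e <= b ^ e by case: (e) => // e'; rewrite leq_exp2r.
have [k0|k0] := posnP k.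
  apply: leq_trans (leq_addl _ _); apply: leX.
  by rewrite -[leqRHS]muln1 leq_mul2l; rewrite k0 in le_kap; rewrite le_kap orbT.
apply: leq_trans (leq_addr _ _); rewrite -expnMn; apply: leX; nia.
Qed.

(** Irreflexivity of [r] forces the entries of the tuple to be distinct, so they form a set of
    exactly [t] vertices. *)
Lemma clique_tupleP t n (r : rel 'I_n) : irreflexive r ->
  has_clique t r <-> exists x : {ffun 'I_t -> 'I_n}, forall a b, a != b -> r (x a) (x b).
Proof.
move=> r_irr; split=> [[K [Kt Kr]]|[x xr]].
  pose x := [ffun a : 'I_t => enum_val (cast_ord (esym Kt) a)].
  exists x => a b ne; rewrite !ffunE; apply: Kr; rewrite ?enum_valP //.
  by rewrite (inj_eq enum_val_inj) (inj_eq (@cast_ord_inj _ _ _)).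
have x_inj : injective x.
  by move=> a b e; apply/eqP/idPn => /xr; rewrite e r_irr.
exists [set x a | a : 'I_t]; split; first by rewrite card_imset // card_ord.
by move=> _ _ /imsetP[a _ ->] /imsetP[b _ ->]; rewrite (inj_eq x_inj) => /xr.
Qed.

(** * Equivalence of the instance and its kernel *)

Section KernelGraph.
Variables (t : nat) (G : sgraph) (kap k : nat) (rk : {ffun 'I_t -> 'I_(gn G)} -> nat).
Hypotheses (kap_gt0 : 0 < kap) (kap_k : k < kap \/ #|edges G| <= k).
Hypothesis rk_inj : injective rk.
Notation adj := (@gadj G).
Notation fm := (fam adj kap rk t).
Notation KG := (kgraph adj kap rk).
Notation kv := (@kvert _ _ adj kap rk).

Lemma edgesP (H : sgraph) e :
  reflect (exists a b, @gadj H a b /\ e = [set a; b]) (e \in edges H).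
Proof.
apply: (iffP imsetP) => [[[a b]]|[a [b [ab ->]]]].
  by rewrite inE => /= ab ->; exists a, b.
by exists (a, b); rewrite ?inE.
Qed.

Lemma card_edge (H : sgraph) e : e \in edges H -> #|e| <= 2.
Proof. by case/edgesP=> a [b [_ ->]]; rewrite cards2; case: (a != b). Qed.

Lemma fam_adj x a b : fm x -> a != b -> adj (x a) (x b).
Proof.
by move=> /(fam_leq (leq0n t)) /forallP /(_ a) /forallP /(_ b) /implyP.
Qed.

Lemma kadj_adj a b : @gadj KG a b -> adj (kv a) (kv b).
Proof.
move=> /kadjP[ne [x famx [c [d [xc xd]]]]]; rewrite -xc -xd; apply: fam_adj => //.
by apply/eqP => e; apply: ne; rewrite -xc -xd e.
Qed.

(** [kv] embeds the kernel graph into [G], so a solution is pulled back along it; [kap] does not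
    enter this direction. *)
Lemma yes_to_kernel : yes_instance t G k -> yes_instance t KG k.
Proof.
case=> F [FE Fk NF]; pose F' := [set e in edges KG | kv @: e \in F].
have kvs_inj : injective (fun e : {set 'I_(gn KG)} => kv @: e).
  exact: imset_inj (@kvert_inj _ _ adj kap rk).
exists F'; split.
- by apply/subsetP => e; rewrite inE => /andP[].
- apply: leq_trans Fk; rewrite -(card_imset _ kvs_inj).
  by apply/subset_leq_card/subsetP => _ /imsetP[e + ->]; rewrite inE => /andP[].
case=> K [Kt KF]; apply: NF; exists (kv @: K); split.
  by rewrite card_imset //; apply: kvert_inj.
move=> _ _ /imsetP[a aK ->] /imsetP[b bK ->] ne.
have ne_ab : a != b by apply: contra ne => /eqP ->.
have /andP[ab abF] := KF a b aK bK ne_ab.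
rewrite (kadj_adj ab) /=; apply: contra abF => abF; rewrite inE imset2 abF andbT.
by apply/edgesP; exists a, b.
Qed.

(** The image of a solution hits every surviving tuple, and [fam_hit_all] extends this to all
    cliques if the image has fewer than [kap] edges. Otherwise [kap_k] allows deleting
    everything. *)
Lemma yes_of_kernel : yes_instance t KG k -> yes_instance t G k.
Proof.
case=> F' [FE' Fk' NF']; pose F := [set kv @: (e : {set 'I_(gn KG)}) | e in F'].
have FE : F \subset edges G.
  apply/subsetP => _ /imsetP[e /(subsetP FE') /edgesP[a [b [ab ->]]] ->].
  by rewrite imset2; apply/edgesP; exists (kv a), (kv b); split=> //; apply: kadj_adj.
have Fk : #|F| <= k by apply: leq_trans (leq_imset_card _ _) Fk'.
(* A survivor that is not hit would be a clique of the kernel graph avoiding [F']. *)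
have famF x : fm x -> hit F x.
  move=> famx; apply: contraT => Nhx; case: NF'.
  have x_onto a : exists b, kv b == x a.
    have [|b bE] := @kvert_onto _ _ adj kap rk (x a); last by exists b; apply/eqP.
    by apply/usedP; exists x => //; exists a.
  pose x' := [ffun a => xchoose (x_onto a)].
  have x'E a : kv (x' a) = x a by rewrite ffunE; apply/eqP/(xchooseP (x_onto a)).
  apply/clique_tupleP; first by move=> a; have /= -> := @gadj_irr KG a.
  exists x' => a b ne; apply/andP; split.
    apply/kadjP; rewrite !x'E; split; last by exists x => //; exists a, b.
    by move=> e; have := fam_adj famx ne; rewrite e gadj_irr.
  apply: contra Nhx => abF; apply/hitP; exists a, b; split=> //.
  by apply/imsetP; exists [set x' a; x' b] => //; rewrite imset2 !x'E.
have conclude (F0 : {set {set 'I_(gn G)}}) : F0 \subset edges G -> #|F0| < kap -> #|F0| <= k ->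
    (forall x, fm x -> hit F0 x) -> yes_instance t G k.
  move=> F0E F0kap F0k hit0; exists F0; split=> //.
  have irr : irreflexive (fun x y => adj x y && ([set x; y] \notin F0)).
    by move=> a; rewrite gadj_irr.
  case/(clique_tupleP t irr) => x xr.
  have /hitP[a [b [ne abF]]] : hit F0 x.
    apply: (@fam_hit_all t _ adj kap kap_gt0 rk rk_inj F0) => //.
      by move=> e /(subsetP F0E)/card_edge.
    apply/forallP => a; apply/forallP => b; apply/implyP => /xr.
    by case/andP.
  by have /andP[_] := xr a b ne; rewrite abF.
(* For [t <= 1] no tuple can be hit, so [famF] says that none survives, and the empty set is a
   solution whatever [kap] is. *)
have [t1|t1] := leqP t 1.
  apply: (conclude set0); rewrite ?sub0set ?cards0 //.
  move=> x /famF/hitP[a [b [/eqP []]]]; apply: val_inj => /=.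
  by have := ltn_ord a; have := ltn_ord b; lia.
case: kap_k => [kk|Ek]; first by apply: (conclude F) => //; apply: leq_ltn_trans kk.
(* Now [t > 1]: any clique has two vertices, and the edge between them is deleted. *)
exists (edges G); split=> // -[K [Kt KE]].
have /card_gt1P[a [b [aK bK ne]]] : 1 < #|K| by rewrite Kt.
have /andP[ab /negP[]] := KE a b aK bK ne.
by apply/edgesP; exists a, b.
Qed.

End KernelGraph.

(** * The kernel as a loop program *)

Lemma all_map_in (S : eqType) R (a : pred R) (f : S -> R) s :
  (forall x, x \in s -> a (f x)) -> all a [seq f x | x <- s].
Proof. by move=> H; rewrite all_map; apply/allP. Qed.

Notation tr w env e := (0 < eval w env e).

Definition EZero := ELt EOne EOne.
Definition ENot e := EIf e EZero EOne.
Definition EAnd a b := EIf a b EZero.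
Definition ELe a b := ENot (ELt b a).
Definition EEq a b := EAnd (ELe a b) (ELe b a).
Definition EAll (s : seq exp) := foldr EAnd EOne s.
Definition EHas (s : seq exp) := foldr EAdd EZero s.
Definition EMulc c e := iter c (EAdd e) EZero.

Fixpoint ESums d l e := if l is l'.+1 then ESum d (ESums d.+1 l' e) else e.

Section Connectives.
Variables (w : seq bool) (env : nat -> nat).

Lemma tr_nat (b : bool) : (0 < b) = b. Proof. by case: b. Qed.

Lemma eval_EVar v : eval w env (EVar v) = env v.
Proof. by []. Qed.

Lemma eval_EAdd a b : eval w env (EAdd a b) = eval w env a + eval w env b.
Proof. by []. Qed.

Lemma eval_EIf a b c :
  eval w env (EIf a b c) = if tr w env a then eval w env b else eval w env c.
Proof. by []. Qed.

Lemma eval_ESum v e : eval w env (ESum v e) = \sum_(i < size w) eval w (updR env v i) e.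
Proof. by []. Qed.

Lemma eval_ERec u v e : eval w env (ERec u v e) =
  iteri (size w) (fun i a => minn (size w) (eval w (updR (updR env u a) v i) e)) 1.
Proof. by []. Qed.

Lemma eval_ENot e : eval w env (ENot e) = ~~ tr w env e.
Proof. by rewrite /=; case: ifP. Qed.

Lemma tr_ENot e : tr w env (ENot e) = ~~ tr w env e.
Proof. by rewrite eval_ENot tr_nat. Qed.

Lemma tr_EAnd a b : tr w env (EAnd a b) = tr w env a && tr w env b.
Proof. by rewrite /=; case: ifP. Qed.

Lemma tr_EAdd a b : tr w env (EAdd a b) = tr w env a || tr w env b.
Proof. by rewrite /= addn_gt0. Qed.

Lemma tr_ELt a b : tr w env (ELt a b) = (eval w env a < eval w env b).
Proof. by rewrite /= tr_nat. Qed.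

Lemma tr_ELe a b : tr w env (ELe a b) = (eval w env a <= eval w env b).
Proof. by rewrite tr_ENot tr_ELt -leqNgt. Qed.

Lemma tr_EEq a b : tr w env (EEq a b) = (eval w env a == eval w env b).
Proof. by rewrite tr_EAnd !tr_ELe eqn_leq. Qed.

Lemma tr_EBit e : tr w env (EBit e) = nth false w (eval w env e).
Proof. by rewrite /= tr_nat. Qed.

Lemma tr_EAll s : tr w env (EAll s) = all (fun e => tr w env e) s.
Proof. by elim: s => // e s IHs; rewrite -[EAll _]/(EAnd e (EAll s)) tr_EAnd IHs. Qed.

Lemma tr_EHas s : tr w env (EHas s) = has (fun e => tr w env e) s.
Proof. by elim: s => // e s IHs; rewrite -[EHas _]/(EAdd e (EHas s)) tr_EAdd IHs. Qed.

Lemma eval_EMulc c e : eval w env (EMulc c e) = c * eval w env e.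
Proof. by elim: c => // c IHc; rewrite /= -/(EMulc c e) IHc mulSn. Qed.

Lemma tr_ESum v e :
  tr w env (ESum v e) = has (fun i => tr w (updR env v i) e) (iota 0 (size w)).
Proof.
rewrite /= lt0n sum_nat_eq0 negb_forall; apply/existsP/hasP => [[i]|[i]].
  by rewrite implybE /= -lt0n => tri; exists (val i) => //; rewrite mem_iota /= ltn_ord.
by rewrite mem_iota /= => lt_i tri; exists (Ordinal lt_i); rewrite -lt0n.
Qed.

End Connectives.

Lemma wf_ESum d v e : wf d (ESum v e) = (v == d) && wf d.+1 e.
Proof. by []. Qed.

Lemma wf_EIf d a b c : wf d (EIf a b c) = [&& wf d a, wf d b & wf d c].
Proof. by []. Qed.

Lemma wf_EAnd d a b : wf d (EAnd a b) = wf d a && wf d b.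
Proof. by rewrite wf_EIf andbT. Qed.

Lemma wf_ELt d a b : wf d (ELt a b) = wf d a && wf d b.
Proof. by []. Qed.

Lemma wf_ELe d a b : wf d (ELe a b) = wf d a && wf d b.
Proof. by rewrite wf_EIf wf_ELt /= andbT andbC. Qed.

Lemma wf_EAll d s : wf d (EAll s) = all (wf d) s.
Proof. by elim: s => //= e s ->; rewrite andbT. Qed.

Lemma wf_EHas d s : wf d (EHas s) = all (wf d) s.
Proof. by elim: s => //= e s ->. Qed.

Lemma wf_EMulc d c e : wf d e -> wf d (EMulc c e).
Proof. by move=> wfe; elim: c => //= c ->; rewrite wfe. Qed.

Lemma wf_ESums d l e : wf (d + l) e -> wf d (ESums d l e).
Proof.
by elim: l d => [|l IHl] d /=; rewrite ?addn0 // eqxx addnS -addSn; apply: IHl.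
Qed.

(** * Tuples held in consecutive variables *)

Fixpoint updL (env : nat -> nat) d (x : seq nat) : nat -> nat :=
  if x is a :: x' then updL (updR env d a) d.+1 x' else env.

Definition vals (env : nat -> nat) b l := [seq env i | i <- iota b l].

Lemma updL_lt env d x i : i < d -> updL env d x i = env i.
Proof.
elim: x env d => //= a x IHx env d lt_i; rewrite IHx; last by lia.
by rewrite updR_ne //; apply/eqP; lia.
Qed.

Lemma vals_updL env d x : vals (updL env d x) d (size x) = x.
Proof.
elim: x env d => //= a x IHx env d; rewrite /vals /= -/(vals _ _ _) IHx.
by rewrite updL_lt // updR_eq.
Qed.

Lemma vals_updL_lt env d x b l : b + l <= d -> vals (updL env d x) b l = vals env b l.
Proof.
move=> le_bd; apply/eq_in_map => i; rewrite mem_iota => /andP[_ lt_i].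
by rewrite updL_lt //; lia.
Qed.

Fixpoint tups (N l : nat) : seq (seq nat) :=
  if l is l'.+1 then [seq a :: x | a <- iota 0 N, x <- tups N l'] else [:: [::]].

Lemma mem_tups N l x : (x \in tups N l) = (size x == l) && all (ltn^~ N) x.
Proof.
elim: l x => [|l IHl] [|a x] //=.
  by apply/negP => /allpairsP[[b y] /= [_ _]].
rewrite eqSS; apply/allpairsP/idP => [[[b y] /= [bN yT [-> ->]]]|].
  by move: bN yT; rewrite mem_iota add0n IHl => /= -> /andP[-> ->].
move=> /and3P[sz aN xN]; exists (a, x); split=> //=; first by rewrite mem_iota.
by rewrite IHl sz.
Qed.

Lemma uniq_tups N l : uniq (tups N l).
Proof.
elim: l => //= l IHl; apply: allpairs_uniq => //; first exact: iota_uniq.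
by move=> [a x] [b y] _ _ /= [-> ->].
Qed.

Lemma eval_ESums w env d l e :
  eval w env (ESums d l e) = \sum_(x <- tups (size w) l) eval w (updL env d x) e.
Proof.
elim: l env d => [|l IHl] env d /=; first by rewrite big_seq1.
rewrite big_allpairs_dep /= -(big_mkord xpredT (fun i => eval w (updR env d i) _)).
by rewrite /index_iota subn0; apply: eq_bigr => a _; rewrite IHl.
Qed.

Lemma tr_ESums w env d l e :
  tr w env (ESums d l e) = has (fun x => tr w (updL env d x) e) (tups (size w) l).
Proof.
rewrite eval_ESums; elim: (tups _ _) => [|x s IHs]; first by rewrite big_nil.
by rewrite big_cons addn_gt0 IHs.
Qed.

Section TupleSeq.
Variables (t n : nat).
Notation T := {ffun 'I_t -> 'I_n}.

Definition seqof (x : T) : seq nat := [seq val (x i) | i <- enum 'I_t].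

Lemma size_seqof x : size (seqof x) = t.
Proof. by rewrite size_map size_enum_ord. Qed.

Lemma seqof_ltn x : all (ltn^~ n) (seqof x).
Proof. by rewrite all_map; apply/allP => i _ /=. Qed.

Lemma nth_seqof x (i : 'I_t) : nth 0 (seqof x) i = x i.
Proof. by rewrite (nth_map i) ?size_enum_ord // nth_ord_enum. Qed.

Lemma seqof_inj : injective seqof.
Proof. by move=> x y e; apply/ffunP => i; apply/val_inj; rewrite /= -!nth_seqof e. Qed.

Lemma seqof_onto s : size s = t -> all (ltn^~ n) s -> exists x, seqof x = s.
Proof.
move=> szs sn; have lt_i (i : 'I_t) : nth 0 s i < n by apply: (allP sn); rewrite mem_nth ?szs.
exists [ffun i => Ordinal (lt_i i)]; apply: (@eq_from_nth _ 0); first by rewrite size_seqof.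
move=> i; rewrite size_seqof => lt_it.
by rewrite (nth_seqof _ (Ordinal lt_it)) ffunE.
Qed.

Lemma perm_tups N : n <= N ->
  perm_eq [seq x <- tups N t | all (ltn^~ n) x] [seq seqof x | x : T].
Proof.
move=> nN; apply: uniq_perm; first by rewrite filter_uniq ?uniq_tups.
  by rewrite map_inj_uniq ?enum_uniq //; apply: seqof_inj.
move=> s; rewrite mem_filter mem_tups; apply/idP/mapP => [/and3P[sn /eqP szs _]|[x _ ->]].
  by have [x xs] := seqof_onto szs sn; exists x; rewrite ?mem_enum.
rewrite size_seqof eqxx seqof_ltn /=.
by apply: sub_all (seqof_ltn x) => a /= lt_a; apply: leq_trans lt_a nN.
Qed.

(** The program sums over tuples of input positions, which are more than the vertices. The sum
    counts vertex tuples only if all terms with an entry outside the graph vanish. *)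
Lemma sum_tups N (f : seq nat -> nat) (P : pred T) : n <= N ->
  (forall s, size s = t -> ~~ all (ltn^~ n) s -> f s = 0) ->
  (forall x, f (seqof x) = P x) ->
  \sum_(s <- tups N t) f s = #|[set x | P x]|.
Proof.
move=> nN f0 fP; rewrite (bigID (all (ltn^~ n))) /= [X in _ + X]big1_seq ?addn0.
  rewrite -big_filter (perm_big _ (perm_tups nN)) big_map big_enum /=.
  rewrite (eq_bigr _ (fun x _ => fP x)) -sum1dep_card [RHS]big_mkcond /=.
  by apply: eq_bigr => x _; case: (P x).
by move=> s /andP[Ns]; rewrite mem_tups => /andP[/eqP szs _]; apply: f0.
Qed.

Lemma has_tups N (f : pred (seq nat)) (P : pred T) : n <= N ->
  (forall s, size s = t -> ~~ all (ltn^~ n) s -> f s = false) ->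
  (forall x, f (seqof x) = P x) ->
  has f (tups N t) = [exists x, P x].
Proof.
move=> nN f0 fP; apply/hasP/existsP => [[s + fs]|[x Px]].
  rewrite mem_tups => /andP[/eqP szs _].
  have [sn|sn] := boolP (all (ltn^~ n) s); last by rewrite f0 in fs.
  by have [x xs] := seqof_onto szs sn; exists x; rewrite -fP xs.
exists (seqof x); last by rewrite fP.
rewrite mem_tups size_seqof eqxx /=.
by apply: sub_all (seqof_ltn x) => a /= lt_a; apply: leq_trans lt_a nN.
Qed.

(** The numeral [s] in base [n]. Its order is lexicographic, so the program compares ranks entry by
    entry and never computes them. *)
Fixpoint code (s : seq nat) : nat := if s is a :: s' then a * n ^ size s' + code s' else 0.

Fixpoint lexs (s1 s2 : seq nat) : bool :=
  match s1, s2 with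
  | a :: s1', b :: s2' => (a < b) || ((a == b) && lexs s1' s2')
  | _, _ => false
  end.

Lemma code_lt s : all (ltn^~ n) s -> code s < n ^ size s.
Proof.
elim: s => //= a s IHs /andP[lt_a /IHs lt_s]; rewrite expnS.
by apply: (@leq_trans (a.+1 * n ^ size s)); [rewrite mulSn; lia | rewrite leq_mul2r lt_a orbT].
Qed.

Lemma code_lexs s1 s2 : size s1 = size s2 -> all (ltn^~ n) s1 -> all (ltn^~ n) s2 ->
  lexs s1 s2 = (code s1 < code s2).
Proof.
elim: s1 s2 => [|a s1 IHs] [|b s2] //= [sz] /andP[an s1n] /andP[bn s2n].
have lt1 := code_lt s1n; have lt2 := code_lt s2n; rewrite sz in lt1 *.
move: (n ^ size s2) lt1 lt2 => X lt1 lt2.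
have [ab|ab|->] := ltngtP a b; rewrite /=.
- by apply/esym; have := leq_mul ab (leqnn X); lia.
- by apply/esym/negP; have := leq_mul ab (leqnn X); lia.
by rewrite IHs // ltn_add2l.
Qed.

Lemma code_inj s1 s2 : size s1 = size s2 -> all (ltn^~ n) s1 -> all (ltn^~ n) s2 ->
  code s1 = code s2 -> s1 = s2.
Proof.
elim: s1 s2 => [|a s1 IHs] [|b s2] //= [sz] /andP[an s1n] /andP[bn s2n].
have lt1 := code_lt s1n; have lt2 := code_lt s2n; rewrite sz in lt1 *.
move: (n ^ size s2) lt1 lt2 => X lt1 lt2.
have [ab|ab|->] := ltngtP a b.
- by have := leq_mul ab (leqnn X); lia.
- by have := leq_mul ab (leqnn X); lia.
by move/addnI/(IHs _ sz s1n s2n) => ->.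
Qed.

Definition lexrk (x : T) := code (seqof x).

Lemma lexrk_inj : injective lexrk.
Proof.
move=> x y /code_inj e; apply: seqof_inj; apply: e; rewrite ?size_seqof ?seqof_ltn //.
Qed.

Lemma lexs_rk x y : lexs (seqof x) (seqof y) = (lexrk x < lexrk y).
Proof. by rewrite code_lexs ?size_seqof ?seqof_ltn. Qed.

End TupleSeq.

(** * The program text *)

Section Programs.
Variable t : nat.

(** The encoding starts with [n] ones and a zero, so [n] is the number of positions up to which only
    ones occur. *)
Definition nE d := ESum d (ENot (ESum d.+1
  (EAnd (ELe (EVar d.+1) (EVar d)) (ENot (EBit (EVar d.+1)))))).

(** Multiplication by [n] as a sum over the positions below [e]; it is correct as long as [e] is at
    most the word length. *)
Definition mulnE d e := ESum d (EIf (ELt (EVar d) e) (nE d.+1) EZero).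

(** The position of the first bit of [k], behind the unary vertex count, the separator and the
    matrix. *)
Definition offE d := EAdd (EAdd EOne (nE d)) (mulnE d (nE d.+1)).

Definition adjE d x y := EBit (EAdd (EAdd EOne (nE d)) (EAdd (mulnE d (EVar x)) (EVar y))).

(** Doubles once per position from the offset up to the one held in variable [d]: the weight of that
    bit of [k], capped at the word length. *)
Definition pow2E d := ERec d.+1 d.+2
  (EIf (EAnd (ELe (offE d.+3) (EVar d.+2)) (ELt (EVar d.+2) (EVar d)))
       (EAdd (EVar d.+1) (EVar d.+1)) (EVar d.+1)).

Definition khatE d := ESum d
  (EIf (EAnd (ELe (offE d.+1) (EVar d)) (EBit (EVar d))) (pow2E d) EZero).

(** Exactly [kap] positions are at most [khat], so each nested sum contributes the factor [kap];
    this explains the form of [kap] below. *)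
Fixpoint powkE e d := if e is e'.+1
  then ESum d (EIf (ELe (EVar d) (khatE d.+1)) (EMulc (4 * t * t + 1) (powkE e' d.+1)) EZero)
  else EOne.

(** The first list checks that the entries are vertices, as variables range over all input
    positions. *)
Definition cliqE d b := EAll
  ([seq ELt (EVar (b + i)) (nE d) | i <- iota 0 t] ++
   [seq (if i == j then EOne else adjE d (b + i) (b + j)) | i <- iota 0 t, j <- iota 0 t]).

Fixpoint lexE l d b := if l is l'.+1
  then EAdd (ELt (EVar d) (EVar b)) (EAnd (EEq (EVar d) (EVar b)) (lexE l' d.+1 b.+1))
  else EZero.

Definition agreeE (P : {set 'I_t}) d b :=
  EAll [seq EEq (EVar (d + val i)) (EVar (b + val i)) | i <- enum P].

(** The tested tuple sits at [b], the competing ones at [d]. The sets [P] are listed when the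
    program is built; for constant [t] its size is constant. *)
Fixpoint famE j d b := if j is j'.+1
  then EAnd (famE j' d b)
    (EAll [seq ELt (ESums d t (EIf (EAnd (famE j' (d + t) d)
                                         (EAnd (agreeE P d b) (lexE t d b))) EOne EZero))
                   (powkE (t - maxn (t - j'.+1) 1) d)
          | P : {set 'I_t} <- enum {set 'I_t} & #|P| == t - j'.+1])
  else cliqE d b.

Definition occursE d v := EHas [seq EEq (EVar (d + i)) (EVar v) | i <- iota 0 t].

Definition usedE d v := ESums d t (EAnd (famE t (d + t) d) (occursE d v)).

Definition kadjE d u v := EAnd (ENot (EEq (EVar u) (EVar v)))
  (ESums d t (EAnd (famE t (d + t) d) (EAnd (occursE d u) (occursE d v)))).

(** Prints the parts of [encode] in their order; the bits of [k] are copied unchanged, without the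
    cap. *)
Definition kernel_cmd :=
  CSeq (CFor 0 (CIf (usedE 1 0) (CEmit EOne)))
  (CSeq (CEmit EZero)
  (CSeq (CFor 0 (CIf (usedE 1 0) (CFor 1 (CIf (usedE 2 1) (CEmit (kadjE 2 0 1))))))
        (CFor 0 (CIf (ELe (offE 1) (EVar 0)) (CEmit (EBit (EVar 0))))))).

Lemma wf_nE d : wf d (nE d).
Proof. by rewrite /=; lia. Qed.

Lemma wf_offE d : wf d (offE d).
Proof. by rewrite /offE /=; lia. Qed.

Lemma wf_adjE d x y : x < d -> y < d -> wf d (adjE d x y).
Proof. by rewrite /adjE /=; lia. Qed.

Lemma wf_khatE d : wf d (khatE d).
Proof. by rewrite /khatE /pow2E /=; lia. Qed.

Lemma wf_powkE e d : wf d (powkE e d).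
Proof.
elim: e d => // e IHe d.
rewrite [powkE _ _]/= wf_ESum wf_EIf wf_ELe wf_khatE wf_EMulc // eqxx.
by rewrite /= ltnSn.
Qed.

Lemma wf_cliqE d b : b + t <= d -> wf d (cliqE d b).
Proof.
move=> bd; rewrite wf_EAll all_cat; apply/andP; split.
  apply: all_map_in => i; rewrite mem_iota => lt_i.
  by rewrite wf_ELt wf_nE /=; lia.
apply/all_allpairsP => i j; rewrite !mem_iota => lt_i lt_j.
by case: eqP => // _; apply: wf_adjE; lia.
Qed.

Lemma wf_lexE l d b d' : d + l <= d' -> b + l <= d' -> wf d' (lexE l d b).
Proof.
elim: l d b => // l IHl d b dd bd.
by rewrite /= IHl ?andbT; lia.
Qed.

Lemma wf_agreeE P d b d' : d + t <= d' -> b + t <= d' -> wf d' (agreeE P d b).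
Proof.
move=> dd bd; rewrite wf_EAll all_map; apply/allP => i _ /=.
by have := ltn_ord i; lia.
Qed.

Lemma wf_famE j d b : b + t <= d -> wf d (famE j d b).
Proof.
elim: j d b => [|j IHj] d b bd; first exact: wf_cliqE.
rewrite [famE _ _ _]/= wf_EAnd IHj // wf_EAll; apply: all_map_in => P _.
rewrite wf_ELt wf_powkE andbT; apply: wf_ESums; rewrite wf_EIf !wf_EAnd.
by rewrite IHj ?wf_agreeE ?wf_lexE //; lia.
Qed.

Lemma wf_occursE d v d' : d + t <= d' -> v < d' -> wf d' (occursE d v).
Proof.
move=> dd vd; rewrite wf_EHas all_map; apply/allP => i; rewrite mem_iota => lt_i /=.
by lia.
Qed.

Lemma wf_usedE d v : v < d -> wf d (usedE d v).
Proof.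
move=> vd; apply: wf_ESums; rewrite wf_EAnd.
by rewrite wf_famE ?wf_occursE //; lia.
Qed.

Lemma wf_kadjE d u v : u < d -> v < d -> wf d (kadjE d u v).
Proof.
move=> ud vd; rewrite wf_EAnd; apply/andP; split; first by rewrite /=; lia.
apply: wf_ESums; rewrite !wf_EAnd.
by rewrite wf_famE ?wf_occursE //; lia.
Qed.

Lemma cwf_kernel_cmd : cwf 0 kernel_cmd.
Proof.
have := wf_kadjE (isT : 0 < 2) (isT : 1 < 2); have := wf_usedE (isT : 1 < 2).
have := wf_usedE (isT : 0 < 1); have := wf_offE 1.
rewrite /kernel_cmd; move: (usedE _ _) (usedE _ _) (kadjE _ _ _) (offE _) => a b c e.
by move=> /= -> -> -> ->.
Qed.

End Programs.

Lemma nth_allpairs (S1 S2 R : Type) (f : S1 -> S2 -> R) x1 x2 r s1 s2 i j :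
  i < size s1 -> j < size s2 ->
  nth r [seq f x y | x <- s1, y <- s2] (i * size s2 + j) = f (nth x1 s1 i) (nth x2 s2 j).
Proof.
elim: s1 i => [|x s1 IHs] [|i] // lt_i lt_j; rewrite allpairs_cons nth_cat size_map.
  by rewrite lt_j (nth_map x2).
rewrite ifN; last by rewrite mulSn; lia.
by rewrite (_ : _ - _ = i * size s2 + j) ?IHs // mulSn; lia.
Qed.

Lemma sum_ltn_const N a b : a <= N -> \sum_(i < N) (if i < a then b else 0) = a * b.
Proof.
move=> aN; rewrite -big_mkcond -(big_ord_widen N (fun=> b)) //.
by rewrite sum_nat_const card_ord.
Qed.

Lemma bin_auxE f k : k <= f ->
  \sum_(i < size (bin_aux f k)) nth false (bin_aux f k) i * 2 ^ i = k.
Proof.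
elim: f k => [|f IHf] [|k] //= le_kf; rewrite ?big_ord0 // big_ord_recl /= expn0 muln1.
rewrite -[RHS]/(k.+1) -[RHS](odd_double_half k.+1); congr (_ + _).
rewrite -[in RHS](IHf (k.+1)./2); last first.
  by have := odd_double_half k.+1; rewrite /= -muln2; lia.
rewrite -muln2 mulnC big_distrr /=; apply: eq_bigr => i _.
by rewrite /bump /= add1n expnS add0n mulnCA.
Qed.

Arguments encode : simpl never.

Lemma allpairs_tnth (S R : Type) (f : S -> S -> R) (s : seq S) :
  [seq f (tnth (in_tuple s) a) (tnth (in_tuple s) b) | a <- enum 'I_(size s), b <- enum 'I_(size s)]
  = [seq f x y | x <- s, y <- s].
Proof.
have e : map (tnth (in_tuple s)) (enum 'I_(size s)) = s := map_tnth_enum (in_tuple s).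
by rewrite -[in RHS]e allpairs_mapl allpairs_mapr.
Qed.

(** * Correctness of the program on an encoded instance *)

Section EncodedInstance.
Variables (t : nat) (G : sgraph) (k : nat).
Notation w := (encode (G, k)).
Notation n := (gn G).
Notation N := (size w).
Notation off := (1 + n + n * n).

Lemma size_encode : N = off + size (bin k).
Proof.
rewrite /encode size_cat size_nseq /= size_cat size_allpairs !size_enum_ord.
by lia.
Qed.

Lemma encode_vertex i : i < n -> nth false w i.
Proof. by move=> lt_i; rewrite /encode nth_cat size_nseq lt_i nth_nseq lt_i. Qed.

Lemma encode_sep : nth false w n = false.
Proof. by rewrite /encode nth_cat size_nseq ltnn subnn. Qed.

Lemma encode_adj (i j : 'I_n) : nth false w (1 + n + (i * n + j)) = gadj i j.
Proof.
rewrite /encode nth_cat size_nseq ifN; last by lia.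
rewrite (_ : _ - _ = (i * n + j).+1); last by lia.
rewrite /= nth_cat size_allpairs !size_enum_ord ifT; last first.
  by have := ltn_ord i; have := ltn_ord j; nia.
have := @nth_allpairs _ _ _ (@gadj G) i j false (enum 'I_n) (enum 'I_n) i j.
by rewrite !size_enum_ord !nth_ord_enum; apply.
Qed.

Lemma encode_bin i : nth false w (off + i) = nth false (bin k) i.
Proof.
rewrite /encode nth_cat size_nseq ifN; last by lia.
rewrite (_ : _ - _ = (n * n + i).+1); last by lia.
rewrite /= nth_cat size_allpairs !size_enum_ord ifN; last by lia.
by congr nth; lia.
Qed.

(** Loops over input positions are long enough to compute [n * n], and a budget [k] of at least the
    word length exceeds the number of edges. *)
Lemma size_encode_gt : n * n + n < N.
Proof. by rewrite size_encode; lia. Qed.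

Lemma eval_nE env d : eval w env (nE d) = n.
Proof.
rewrite eval_ESum.
have nN : n <= N by have := size_encode_gt; lia.
rewrite -[RHS]muln1 -(@sum_ltn_const N n 1) //; apply: eq_bigr => x _.
rewrite eval_ENot tr_ESum (_ : ~~ _ = (x < n)); first by case: (x < n).
apply/hasPn/idP => [H|lt_x y _].
  rewrite ltnNge; apply/negP => le_nx.
  (* The separator at position [n] is a zero not beyond [x]. *)
  have /H : n \in iota 0 N by rewrite mem_iota; have := size_encode_gt; lia.
  rewrite tr_EAnd tr_ELe tr_ENot tr_EBit !eval_EVar updR_eq encode_sep.
  by rewrite updR_ne ?updR_eq ?le_nx //; apply/eqP; lia.
rewrite tr_EAnd tr_ELe tr_ENot tr_EBit negb_and negbK !eval_EVar updR_eq.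
rewrite updR_ne ?updR_eq; last by apply/eqP; lia.
by rewrite -implybE; apply/implyP => le_yx; apply: encode_vertex; lia.
Qed.

Lemma eval_mulnE env d e a : a <= N -> (forall x, eval w (updR env d x) e = a) ->
  eval w env (mulnE d e) = a * n.
Proof.
move=> aN ea; rewrite -(sum_ltn_const _ aN).
rewrite eval_ESum; apply: eq_bigr => i _.
by rewrite eval_EIf eval_nE tr_ELt ea eval_EVar updR_eq.
Qed.

Lemma eval_offE env d : eval w env (offE d) = off.
Proof.
rewrite !eval_EAdd eval_nE (@eval_mulnE _ _ _ n) //; last by move=> x; apply: eval_nE.
by have := size_encode_gt; lia.
Qed.

Lemma tr_adjE (env : nat -> nat) d x y (i j : 'I_n) : x < d -> env x = i -> env y = j ->
  tr w env (adjE d x y) = gadj i j.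
Proof.
move=> xd xi yj; rewrite tr_EBit !eval_EAdd eval_nE (@eval_mulnE _ _ _ i).
- by rewrite -encode_adj /= yj.
- by have := size_encode_gt; have := ltn_ord i; lia.
by move=> a /=; rewrite updR_ne ?xi //; apply/eqP; lia.
Qed.

Lemma eval_pow2E env d : env d <= N -> eval w env (pow2E d) = minn N (2 ^ (env d - off)).
Proof.
move=> dN.
pose f i a := minn N (if (off <= i) && (i < env d) then a + a else a).
have -> : eval w env (pow2E d) = iteri N f 1.
  rewrite eval_ERec; apply: eq_iteri => i a; rewrite /f; congr minn.
  rewrite eval_EIf tr_EAnd tr_ELe tr_ELt.
  rewrite eval_offE eval_EAdd !eval_EVar updR_eq.
  by rewrite !(@updR_ne _ d.+2) ?updR_eq ?(@updR_ne _ d.+1) //; apply/eqP; lia.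
have N0 : 0 < N by have := size_encode_gt; lia.
(* Capping after every doubling has the same effect as capping once at the end. *)
suff H x : iteri x f 1 = minn N (2 ^ (minn x (env d) - off)).
  by rewrite H (minn_idPr dN).
elim: x => [|x IHx]; first by rewrite min0n sub0n expn0 (minn_idPr N0).
rewrite -[LHS]/(f x (iteri x f 1)) IHx /f; case: ifP => [/andP[le_x lt_x]|cond].
  rewrite (_ : minn x.+1 _ - off = (minn x (env d) - off).+1); last by lia.
  by rewrite expnS; move: (2 ^ _) => p; lia.
rewrite minnA minnn; congr (minn _ (2 ^ _)).
by move: cond => /negbT; lia.
Qed.

Definition khat := \sum_(i < size (bin k)) (if nth false (bin k) i then minn N (2 ^ i) else 0).

Lemma eval_khatE env d : eval w env (khatE d) = khat.
Proof.
rewrite eval_ESum -(big_mkord xpredT (fun x => eval w (updR env d x) _)).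
rewrite (@big_cat_nat _ _ _ off) //; last by have := size_encode; lia.
rewrite big1_seq ?add0n => [|x /andP[_]]; last first.
  rewrite mem_index_iota => /andP[_ lt_x].
  rewrite eval_EIf tr_EAnd tr_ELe eval_offE eval_EVar updR_eq leqNgt lt_x.
  by [].
rewrite -{1}[off]add0n big_addn big_mkord.
have -> : N - off = size (bin k) by have := size_encode; lia.
apply: eq_bigr => i _.
rewrite eval_EIf tr_EAnd tr_ELe tr_EBit eval_offE eval_EVar updR_eq leq_addl addnC encode_bin.
rewrite eval_pow2E updR_eq ?addKn //; have := size_encode; have := ltn_ord i; lia.
Qed.

Definition kap := minn N khat.+1.

Lemma kap_gt0 : 0 < kap.
Proof. by rewrite /kap; have := size_encode_gt; lia. Qed.

Lemma khat_leq : khat <= k.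
Proof.
rewrite -[X in _ <= X](@bin_auxE k k) //; apply: leq_sum => i _.
by case: (nth _ _ _); rewrite ?mul1n ?geq_minr.
Qed.

(** A set bit of weight above [N] contributes [N] by itself; if there is none, no cap is active. *)
Lemma khat_cases : khat = k \/ N <= khat.
Proof.
have [/existsP[i /andP[bi Ni]]|/existsPn H] :=
  boolP [exists i : 'I_(size (bin k)), nth false (bin k) i && (N < 2 ^ i)].
  by right; rewrite /khat (bigD1 i) //= bi; lia.
left; rewrite -[RHS](@bin_auxE k k) //; apply: eq_bigr => i _.
have := H i; rewrite -/(bin k); case: (nth _ _ _) => //=.
by rewrite -leqNgt mul1n => /minn_idPr.
Qed.

Lemma kap_leq : kap <= k.+1.
Proof. by rewrite /kap; have := khat_leq; lia. Qed.

Lemma card_edges_leq (H : sgraph) : #|edges H| <= gn H * gn H.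
Proof.
apply: leq_trans (leq_imset_card _ _) _; apply: leq_trans (max_card _) _.
by rewrite card_prod card_ord.
Qed.

(** Unless [kap = k + 1], one has [k >= N > n * n], and [n * n] bounds the number of edges. *)
Lemma kap_cases : k < kap \/ #|edges G| <= k.
Proof.
have := khat_cases; have := khat_leq; have := card_edges_leq G; have := size_encode_gt.
rewrite /kap => ? ? ? [?|?]; last by right; lia.
have [?|?] := leqP khat.+1 N; [left|right]; lia.
Qed.

Lemma eval_powkE env e d : eval w env (powkE t e d) = ((4 * t * t + 1) * kap) ^ e.
Proof.
elim: e env d => // e IHe env d; rewrite [powkE _ _ _]/= eval_ESum expnS.
set c := 4 * t * t + 1.
rewrite (eq_bigr (fun i : 'I_N => if i < kap then c * (c * kap) ^ e else 0)); last first.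
  move=> i _; rewrite eval_EIf tr_ELe eval_khatE eval_EVar updR_eq eval_EMulc IHe.
  by congr (if _ then _ else _); rewrite /kap; have := ltn_ord i; lia.
by rewrite sum_ltn_const ?geq_minl // mulnA [kap * c]mulnC.
Qed.

Notation T := {ffun 'I_t -> 'I_n}.
Notation rk := (@lexrk t n).
Notation fm := (fam (@gadj G) kap rk).

Lemma vals_env env b (x : T) (i : 'I_t) : vals env b t = seqof x -> env (b + i) = x i.
Proof.
move=> e; have := nth_seqof x i; rewrite -e (nth_map 0) ?size_iota // nth_iota //.
Qed.

Lemma tr_cliqE env d b (x : T) : b + t <= d -> vals env b t = seqof x ->
  tr w env (cliqE t d b) = cliq (@gadj G) x.
Proof.
move=> bd ex; rewrite tr_EAll all_cat (_ : all _ _ = true); last first.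
  apply: all_map_in => i; rewrite mem_iota add0n => lt_i.
  by rewrite tr_ELt eval_nE eval_EVar (@vals_env _ _ x (Ordinal lt_i)).
rewrite andTb; apply/all_allpairsP/forallP => [H i|H i j].
  apply/forallP => j; apply/implyP => ne.
  have := H (val i) (val j); rewrite !mem_iota !add0n !ltn_ord => /(_ isT isT).
  rewrite ifN // (@tr_adjE _ _ _ _ (x i) (x j)) //.
  - by apply: leq_trans bd; rewrite ltn_add2l; apply: ltn_ord.
  - exact: vals_env ex.
  exact: vals_env ex.
rewrite !mem_iota !add0n => /= lt_i lt_j; case: eqP => // /eqP ne.
rewrite (@tr_adjE _ _ _ _ (x (Ordinal lt_i)) (x (Ordinal lt_j))).
- by have /forallP/(_ (Ordinal lt_j))/implyP := H (Ordinal lt_i); apply.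
- by lia.
- exact: (@vals_env _ _ x (Ordinal lt_i)).
exact: (@vals_env _ _ x (Ordinal lt_j)).
Qed.

Lemma tr_cliqE_ltn env d b : tr w env (cliqE t d b) -> all (ltn^~ n) (vals env b t).
Proof.
rewrite tr_EAll all_cat => /andP[+ _]; rewrite all_map => /allP H.
rewrite /vals -{1}[b]addn0 iotaDl -map_comp; apply: all_map_in => i /H.
by rewrite -[X in is_true X -> _]/(tr w env (ELt (EVar (b + i)) (nE d))) tr_ELt eval_nE.
Qed.

Lemma tr_lexE env l d b : tr w env (lexE l d b) = lexs (vals env d l) (vals env b l).
Proof.
elim: l d b => // l IHl d b.
rewrite [lexE _ _ _]/= tr_EAdd tr_ELt tr_EAnd tr_EEq IHl.
by [].
Qed.

Lemma tr_agreeE env P d b (x y : T) : vals env d t = seqof y -> vals env b t = seqof x ->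
  tr w env (agreeE P d b) = agree P x y.
Proof.
move=> ey ex; rewrite tr_EAll all_map.
apply/allP/agreeP => [H i iP|H i iP].
  have := H i; rewrite mem_enum => /(_ iP); rewrite [preim _ _ _]/=.
  rewrite -[X in is_true X]/(tr w env (EEq (EVar (d + val i)) (EVar (b + val i)))) tr_EEq.
  by rewrite !eval_EVar (vals_env _ ey) (vals_env _ ex) => /eqP/val_inj.
rewrite mem_enum in iP.
rewrite -[X in is_true X]/(tr w env (EEq (EVar (d + val i)) (EVar (b + val i)))) tr_EEq.
by rewrite !eval_EVar (vals_env _ ey) (vals_env _ ex) H.
Qed.

(** Every level contains the range check of [cliqE]; this is the vanishing that [sum_tups] and
    [has_tups] ask for. *)
Lemma tr_famE_ltn env j d b : tr w env (famE t j d b) -> all (ltn^~ n) (vals env b t).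
Proof.
elim: j => [|j IHj]; first exact: tr_cliqE_ltn.
by rewrite [famE _ _ _ _]/= tr_EAnd => /andP[/IHj].
Qed.

Lemma leq_nN : n <= N.
Proof. by have := size_encode_gt; lia. Qed.

Lemma tr_famE env j d b (x : T) : b + t <= d -> vals env b t = seqof x ->
  tr w env (famE t j d b) = fm j x.
Proof.
elim: j env d b x => [|j IHj] env d b x bd ex; first exact: tr_cliqE.
rewrite [famE _ _ _ _]/= tr_EAnd famS (IHj _ _ _ x) //; congr andb.
rewrite tr_EAll all_map.
have countE P : tr w env
   (ELt (ESums d t (EIf (EAnd (famE t j (d + t) d) (EAnd (agreeE P d b) (lexE t d b))) EOne EZero))
        (powkE t (t - maxn (t - j.+1) 1) d)) =
   (#|[set y | [&& fm j y, agree P x y & rk y < rk x]]| < thr t kap (t - j.+1)).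
  rewrite tr_ELt eval_powkE eval_ESums; congr (_ < _).
  apply: (sum_tups leq_nN) => [s szs Ns|y].
    rewrite eval_EIf tr_EAnd ifN // negb_and; apply/orP; left.
    by apply: contra Ns => /tr_famE_ltn; rewrite -[X in vals _ _ X]szs vals_updL.
  have ey : vals (updL env d (seqof y)) d t = seqof y.
    by rewrite -[X in vals _ _ X](size_seqof y) vals_updL.
  have ex' : vals (updL env d (seqof y)) b t = seqof x by rewrite vals_updL_lt.
  rewrite eval_EIf !tr_EAnd (IHj _ _ _ y) // (tr_agreeE _ ey ex') tr_lexE ey ex' lexs_rk.
  by case: ifP.
apply/allP/forall_inP => [H P Pj|H P].
  by rewrite -countE; apply: (H P); rewrite mem_filter Pj mem_enum.
by rewrite mem_filter => /andP[/H + _]; rewrite -countE.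
Qed.

Lemma tr_occursE env d v (y : T) (i : nat) : vals env d t = seqof y -> env v = i ->
  tr w env (occursE t d v) = [exists a, val (y a) == i].
Proof.
move=> ey vi; rewrite tr_EHas has_map; apply/hasP/existsP => [[a]|[a /eqP ya]].
  rewrite mem_iota add0n => lt_a.
  rewrite -[X in is_true X]/(tr w env (EEq (EVar (d + a)) (EVar v))) tr_EEq !eval_EVar vi.
  by rewrite (@vals_env _ _ y (Ordinal lt_a)) // => ya; exists (Ordinal lt_a).
exists (val a); first by rewrite mem_iota add0n ltn_ord.
rewrite -[X in is_true X]/(tr w env (EEq (EVar (d + val a)) (EVar v))) tr_EEq !eval_EVar vi.
by rewrite (vals_env _ ey) ya.
Qed.

Lemma tr_usedE env d v : v < d ->
  tr w env (usedE t d v) = [exists x, fm t x && [exists a, val (x a) == env v]].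
Proof.
move=> vd; rewrite tr_ESums; apply: (has_tups leq_nN) => [s szs Ns|y].
  apply: contraNF Ns; rewrite tr_EAnd => /andP[/tr_famE_ltn + _].
  by rewrite -[X in vals _ _ X]szs vals_updL.
have ey : vals (updL env d (seqof y)) d t = seqof y.
  by rewrite -[X in vals _ _ X](size_seqof y) vals_updL.
rewrite tr_EAnd (@tr_famE _ _ _ _ y) // (@tr_occursE _ _ _ y (env v)) //.
by rewrite updL_lt.
Qed.

Lemma tr_usedE_ord (env : nat -> nat) d v (i : 'I_n) : v < d -> env v = i ->
  tr w env (usedE t d v) = used (@gadj G) kap rk i.
Proof. by move=> vd vi; rewrite tr_usedE // vi. Qed.

Lemma tr_usedE_ltn env d v : v < d -> tr w env (usedE t d v) -> env v < n.
Proof.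
move=> vd; rewrite tr_usedE // => /existsP[x /andP[_ /existsP[a /eqP <-]]].
exact: ltn_ord.
Qed.

Lemma tr_kadjE (env : nat -> nat) d u v (i j : 'I_n) : u < d -> v < d -> env u = i -> env v = j ->
  tr w env (kadjE t d u v) = kadj (@gadj G) kap rk i j.
Proof.
move=> ud vd ui vj; rewrite tr_EAnd tr_ENot tr_EEq !eval_EVar ui vj; congr andb.
rewrite tr_ESums; apply: (has_tups leq_nN) => [s szs Ns|y].
  apply: contraNF Ns; rewrite tr_EAnd => /andP[/tr_famE_ltn + _].
  by rewrite -[X in vals _ _ X]szs vals_updL.
have ey : vals (updL env d (seqof y)) d t = seqof y.
  by rewrite -[X in vals _ _ X](size_seqof y) vals_updL.
rewrite !tr_EAnd (@tr_famE _ _ _ _ y) //.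
rewrite (@tr_occursE _ _ u y i) ?updL_lt // (@tr_occursE _ _ v y j) ?updL_lt //.
Qed.

Notation KG := (kgraph (@gadj G) kap rk).
Notation KV := (kverts (@gadj G) kap rk).

Lemma flatten_if (S R : Type) (p : pred S) (f : S -> seq R) s :
  flatten [seq if p i then f i else [::] | i <- s] = flatten [seq f i | i <- s & p i].
Proof. by elim: s => //= x s IHs; case: (p x); rewrite /= IHs. Qed.

(** As [p] fails from [n] on, the loop over all positions meets exactly the used vertices, in the
    order of [kverts]. *)
Lemma filter_used (p : pred nat) :
  (forall i : 'I_n, p i = used (@gadj G) kap rk i) -> (forall i, p i -> i < n) ->
  [seq i <- iota 0 N | p i] = map val KV.
Proof.
move=> pE pn; rewrite -(subnKC leq_nN) iotaD filter_cat add0n.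
rewrite [X in _ ++ X](_ : _ = [::]) ?cats0.
  rewrite -val_enum_ord filter_map; congr map; apply: eq_filter => i.
  by rewrite /= pE.
apply/eqP; rewrite -(negbK (_ == _)) -has_filter; apply/hasPn => i.
by rewrite mem_iota => /andP[le_i _]; apply: contraL le_i => /pn; rewrite ltnNge.
Qed.

Lemma ceval_kernel_cmd env : ceval w env (kernel_cmd t) = encode (KG, k).
Proof.
have used1 e0 : [seq i <- iota 0 N | tr w (updR e0 0 i) (usedE t 1 0)] = map val KV.
  apply: filter_used => [i|i H]; first by rewrite (@tr_usedE_ord _ _ _ i) ?updR_eq.
  by have := tr_usedE_ltn (isT : 0 < 1) H; rewrite updR_eq.
have used2 e0 : [seq i <- iota 0 N | tr w (updR e0 1 i) (usedE t 2 1)] = map val KV.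
  apply: filter_used => [i|i H]; first by rewrite (@tr_usedE_ord _ _ _ i) ?updR_eq.
  by have := tr_usedE_ltn (isT : 1 < 2) H; rewrite updR_eq.
rewrite /kernel_cmd -[LHS]/(
   flatten [seq if tr w (updR env 0 i) (usedE t 1 0) then [:: true] else [::]
        | i <- iota 0 N] ++ [:: false] ++
   (flatten [seq if tr w (updR env 0 i) (usedE t 1 0) then
        flatten [seq if tr w (updR (updR env 0 i) 1 j) (usedE t 2 1) then
                  [:: tr w (updR (updR env 0 i) 1 j) (kadjE t 2 0 1)] else [::] | j <- iota 0 N]
        else [::] | i <- iota 0 N] ++
    flatten [seq if tr w (updR env 0 i) (ELe (offE 1) (EVar 0)) then
        [:: tr w (updR env 0 i) (EBit (EVar 0))] else [::] | i <- iota 0 N])).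
rewrite /encode; congr (_ ++ _).
  by rewrite flatten_if used1 flatten_map1 -map_comp -[gn KG]/(size KV); elim: KV => //= i s ->.
rewrite cat1s; congr cons; congr (_ ++ _).
  rewrite [RHS](allpairs_tnth (kadj (@gadj G) kap rk) KV).
  rewrite flatten_if used1 -map_comp; congr flatten; apply: eq_map => i.
  rewrite [LHS]/= flatten_if used2 flatten_map1 -map_comp; apply: eq_map => j.
  by rewrite [LHS]/= (@tr_kadjE _ _ _ _ i j) ?updR_eq // updR_ne ?updR_eq.
rewrite flatten_if flatten_map1.
(* The positions from the offset to the end of the word are exactly those of the bits of [k]. *)
have -> : [seq i <- iota 0 N | tr w (updR env 0 i) (ELe (offE 1) (EVar 0))]
          = iota off (size (bin k)).
  rewrite (eq_filter (a2 := leq off)); last first.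
    by move=> i; rewrite tr_ELe eval_offE eval_EVar updR_eq.
  rewrite size_encode iotaD filter_cat add0n [X in X ++ _](_ : _ = [::]) ?cat0s.
    by apply/all_filterP/allP => i; rewrite mem_iota => /andP[].
  apply/eqP; rewrite -(negbK (_ == _)) -has_filter; apply/hasPn => i.
  by rewrite mem_iota -ltnNge => /andP[].
rewrite -[X in iota X _]addn0 iotaDl -map_comp -[RHS](mkseq_nth false) /mkseq.
apply: eq_map => i; rewrite -[LHS]/(tr w (updR env 0 (off + i)) (EBit (EVar 0))).
by rewrite tr_EBit eval_EVar updR_eq encode_bin.
Qed.

End EncodedInstance.

Theorem theorem1 (t : nat) :
  exists C : nat,
  exists kernel : sgraph * nat -> sgraph * nat,
    (exists f : seq bool -> seq bool,
        poly_time_computable f /\ forall I, f (encode I) = encode (kernel I)) /\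
    forall (G : sgraph) (k : nat),
      (yes_instance t G k <-> yes_instance t (kernel (G, k)).1 (kernel (G, k)).2)
      /\ (kernel (G, k)).2 <= k
      /\ gn (kernel (G, k)).1 <= C * k ^ (t - 1) + C
      /\ #|edges (kernel (G, k)).1| <= C * k ^ (t - 1) + C.
Proof.
(* [D] comes from [thr_leq] at [s = 0], where the exponent is [t - 1]. The further factor [t * t]
   counts coordinate pairs for the edges and also covers the factor [t] for the vertices. *)
pose c := 4 * t * t + 1; pose D := (c * 2) ^ (t - 1) + c ^ (t - 1).
exists (D * (t * t)),
  (fun I => (kgraph (@gadj I.1) (kap I.1 I.2) (@lexrk t (gn I.1)), I.2)).
split.
  exists (fun w => ceval w (fun=> 0) (kernel_cmd t)); split.
    exact: cmd_poly_time (cwf_kernel_cmd t).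
  by case=> G k; apply: ceval_kernel_cmd.
move=> G k; rewrite [_.1]/= [_.2]/=.
have kap0 := kap_gt0 G k; have rk_inj := @lexrk_inj t (gn G).
have thrD : thr t (kap G k) 0 <= D * k ^ (t - 1) + D.
  apply: leq_trans (thr_leq t 0 (kap_leq G k)) _; rewrite max0n -/c.
  by rewrite /D mulnDl -!addnA leq_add2l; lia.
have bound a : a <= t * t -> thr t (kap G k) 0 * a <= D * (t * t) * k ^ (t - 1) + D * (t * t).
  move=> le_a; apply: leq_trans (leq_mul thrD le_a) _.
  by rewrite mulnDl mulnAC.
split; [|split; [by [] | split]].
- by split; [apply: yes_to_kernel | apply: yes_of_kernel => //; apply: kap_cases].
- apply: leq_trans (size_kverts _ kap0 rk_inj) (bound _ _).
  by case: (t) => // t'; rewrite leq_pmulr.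
by apply: leq_trans (card_kedges _ kap0 rk_inj) (bound _ _).
Qed.
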